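(* Let $0<\eta<T$, $0<\alpha<\frac{2T}{\eta^2}$ and $0\le\beta<\frac{2T-\alpha\eta^2}{\alpha\eta^2-2\eta+2T}$ be real constants. Let $f\in C([0,\infty),[0,\infty))$, and let $a\in C([0,T],[0,\infty))$ be such that there exists $t_0\in[\eta,T]$ with $a(t_0)>0$. Let $\gamma$, $\Lambda_1$ and $\Lambda_2$ be the constants defined in the context. Suppose that (i) $\rho_1>0$ and $M_1\in(0,\Lambda_1]$ are constants such that $f(u)\le M_1\rho_1$ for all $u\in[0,\rho_1]$; (ii) $\rho_2>0$ and $M_2\in[\Lambda_2,\infty)$ are constants such that $f(u)\ge M_2\rho_2$ for all $u\in[\gamma\rho_2,\rho_2]$; (iii) $\rho_1\ne\rho_2$. Then the boundary value problem $$u''(t)+a(t)f(u(t))=0,\quad 0<t<T,\qquad u(0)=\beta u(\eta),\quad u(T)=\alpha\int_0^\eta u(s)\,ds,$$ has at least one positive solution $u$ satisfying $\rho_1<\|u\|<\rho_2$ or $\rho_2<\|u\|<\rho_1$.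
   Context: $\|u\|=\max_{t\in[0,T]}|u(t)|$ is the sup norm on $C([0,T],\mathbb{R})$. A positive solution of the boundary value problem is a function $u\in C([0,T])$, twice continuously differentiable on $(0,T)$, satisfying the differential equation on $(0,T)$ and both boundary conditions, with $u(t)\ge0$ on $[0,T]$ and $u(t)>0$ for $t\in(0,T)$. Define $$\gamma=\min\left\{\frac{\eta}{T},\ \frac{\alpha(\beta+1)\eta^2}{2T},\ \frac{\alpha(\beta+1)\eta(T-\eta)}{2T-\alpha(\beta+1)\eta^2}\right\}\in(0,1),$$ $$\Lambda_1=\frac{(2T-\alpha\eta^2)-\beta(\alpha\eta^2-2\eta+2T)}{\left[2(\beta+1)+T^{-1}\beta\eta(\alpha\eta+2)+\alpha\beta T\right]\int_0^T T(T-s)a(s)\,ds},$$ $$\Lambda_2=\frac{(2T-\alpha\eta^2)-\beta(\alpha\eta^2-2\eta+2T)}{2\gamma\eta\int_\eta^T(T-s)a(s)\,ds}.$$ *)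

(* Defs.v *)
From Stdlib Require Import Reals.
From Coquelicot Require Import Coquelicot.
Open Scope R_scope.

Definition cc (a b t : R) : Prop := a <= t <= b.

(* The supremum norm of C([0,T]).  [Lub_Rbar] is total; for [u] continuous on
   [0,T] with [0 <= T] the supremum is finite and attained, hence is the
   maximum of |u| over [0,T]. *)
Definition sup_norm (T : R) (u : R -> R) : R :=
  real (Lub_Rbar (fun y => exists t, cc 0 T t /\ y = Rabs (u t))).

(* Both derivatives are required to exist because [Derive] is total:
   [ex_derive (Derive u) t] alone would not make [u] differentiable. *)
Definition C2_open (a b : R) (u : R -> R) : Prop :=
  forall t, a < t < b ->
    ex_derive u t /\ ex_derive (Derive u) t /\ continuous (Derive_n u 2) t.

(* Functions on [0,T] are represented by functions on R; only the values on
   [0,T] matter, since [continuous_on] is continuity relative to the set. *)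
Record bvp_positive_solution (T eta alpha beta : R) (a f u : R -> R) : Prop := {
  sol_continuous : continuous_on (cc 0 T) u;
  sol_C2 : C2_open 0 T u;
  sol_ode : forall t, 0 < t < T -> Derive_n u 2 t + a t * f (u t) = 0;
  sol_left : u 0 = beta * u eta;
  sol_right : u T = alpha * RInt u 0 eta;
  sol_nonneg : forall t, cc 0 T t -> 0 <= u t;
  sol_pos : forall t, 0 < t < T -> 0 < u t
}.

Definition gamma_const (T eta alpha beta : R) : R :=
  Rmin (eta / T)
    (Rmin (alpha * (beta + 1) * eta ^ 2 / (2 * T))
          (alpha * (beta + 1) * eta * (T - eta)
             / (2 * T - alpha * (beta + 1) * eta ^ 2))).

Definition Lambda1 (T eta alpha beta : R) (a : R -> R) : R :=
  ((2 * T - alpha * eta ^ 2) - beta * (alpha * eta ^ 2 - 2 * eta + 2 * T))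
  / ((2 * (beta + 1) + / T * beta * eta * (alpha * eta + 2) + alpha * beta * T)
     * RInt (fun s => T * (T - s) * a s) 0 T).

Definition Lambda2 (T eta alpha beta : R) (a : R -> R) : R :=
  ((2 * T - alpha * eta ^ 2) - beta * (alpha * eta ^ 2 - 2 * eta + 2 * T))
  / (2 * gamma_const T eta alpha beta * eta
     * RInt (fun s => (T - s) * a s) eta T).

(* Main.v *)
(** The solutions are found by shooting from the maximum.  A concave function on
    [0,T] is launched from its maximum [m], attained at a point [c] (with a non-zero
    slope allowed if [c] is an end point of [0,T]), and [m] runs between rho_1 and
    rho_2, so that the norm is one of the two shooting parameters.  The launching
    position is chosen so as to satisfy the condition at T: its defect is negative
    for a steep descent from 0 and positive for a steep ascent to T.  For a shot
    which satisfies the condition at T, the defect u(0) - beta u(eta) must be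
    positive if m = rho_1, since otherwise u lies below the solution of the linear
    problem with right-hand side M_1 rho_1 a, which is smaller than rho_1; and it must
    be negative if m = rho_2, since otherwise u(eta) > rho_2.  The planar
    Poincare-Miranda theorem then gives a common zero.

    As f is merely continuous, shots are not unique.  They are replaced by shots of
    a delayed equation, which depend continuously on the parameters, and the delay
    tends to 0 by the Arzela-Ascoli theorem. *)

Require Import Defs.
From Stdlib Require Import Reals.
From Stdlib Require Import Lra Lia Psatz Classical ClassicalEpsilon.
From Stdlib Require Import FunctionalExtensionality Cantor.
From Coquelicot Require Import Coquelicot.
Open Scope R_scope.

(** * Planar Poincare-Miranda theorem *)

(** The signs of the left defect at m = rho_1 and m = rho_2 are known only for shots of the
    undelayed equation that satisfy the condition at T exactly, which no approximate shot does.
    Hence the planar theorem is stated without signs on these two sides: a wrong sign there is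
    carried along as an alternative, survives the passage to the limit, and is refuted only for the
    limit shot. Both comparisons are strict, so the same refutations also exclude the values rho_1
    and rho_2 for a common zero; this is where the strict bounds on the norm come from.

    The constant gamma enters through concavity: if u satisfies the condition at T and has
    nonnegative left defect, then u is at least gamma times its maximum on [eta,T]. With maximum
    rho_2, the lower bound on f therefore holds on the whole range of the integral in Lambda_2. The
    common numerator of Lambda_1 and Lambda_2 is twice the determinant of the two boundary
    conditions, as equations for u(0) and u'(0). *)

Inductive quadrant := qW | qE | qN | qS.

Definition opposite (x y : quadrant) : Prop :=
  match x, y with
  | qW, qE | qE, qW | qN, qS | qS, qN => True
  | _, _ => False
  end.

Definition is_W (x : quadrant) : bool := match x with qW => true | _ => false end.

(* Mod 2 winding number: in a grid where opposite quadrants are never adjacent,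
   every triangle has an even number of edges between W and N. *)
Definition WN_edge (x y : quadrant) : bool :=
  match x, y with qW, qN | qN, qW => true | _, _ => false end.

Fixpoint row_parity (c : nat -> nat -> quadrant) (j n : nat) : bool :=
  match n with
  | O => false
  | S k => xorb (row_parity c j k) (WN_edge (c k j) (c (S k) j))
  end.

(** Without an opposite pair the three colours come from two neighbouring quadrants, and a closed
    path crosses the border between two regions an even number of times. *)
Lemma WN_edge_triangle (x y z : quadrant) :
  ~ opposite x y -> ~ opposite y z -> ~ opposite x z ->
  xorb (xorb (WN_edge x y) (WN_edge y z)) (WN_edge x z) = false.
Proof. destruct x, y, z; simpl; tauto. Qed.

(** Each square of the strip is cut into two triangles by the diagonal from (i,j) to (i+1,j+1). In
    the sum of the triangle relations mod 2 all inner edges cancel, and the boundary of the strip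
    remains. *)
Lemma row_parity_succ (c : nat -> nat -> quadrant) (j n : nat) :
  (forall i, (i < n)%nat ->
     ~ opposite (c i j) (c (S i) j) /\ ~ opposite (c i (S j)) (c (S i) (S j))
     /\ ~ opposite (c (S i) j) (c (S i) (S j))
     /\ ~ opposite (c i j) (c i (S j)) /\ ~ opposite (c i j) (c (S i) (S j))) ->
  xorb (row_parity c j n) (row_parity c (S j) n)
  = xorb (WN_edge (c O j) (c O (S j))) (WN_edge (c n j) (c n (S j))).
Proof.
  induction n as [|n IH]; intros H; simpl.
  - now rewrite Bool.xorb_nilpotent.
  - assert (IH' := IH (fun i Hi => H i (Nat.lt_lt_succ_r _ _ Hi))). clear IH.
    destruct (H n (Nat.lt_succ_diag_r n)) as (H1 & H2 & H3 & H4 & H5).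
    assert (T1 := WN_edge_triangle _ _ _ H1 H3 H5).
    assert (T2 := WN_edge_triangle _ _ _ H4 H2 H5).
    revert IH' T1 T2.
    destruct (row_parity c j n), (row_parity c (S j) n),
      (WN_edge (c n j) (c (S n) j)), (WN_edge (c n (S j)) (c (S n) (S j))),
      (WN_edge (c (S n) j) (c (S n) (S j))), (WN_edge (c n j) (c (S n) (S j))),
      (WN_edge (c n j) (c n (S j))), (WN_edge (c O j) (c O (S j)));
      simpl; congruence.
Qed.

(* A path from W to E avoiding S crosses between W and N an odd number of times. *)
Lemma row_parity_no_S (c : nat -> nat -> quadrant) (j n : nat) :
  (forall i, (i <= n)%nat -> c i j <> qS) ->
  (forall i, (i < n)%nat -> ~ opposite (c i j) (c (S i) j)) ->
  row_parity c j n = xorb (is_W (c O j)) (is_W (c n j)).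
Proof.
  induction n as [|n IH]; intros HS H; simpl.
  - now rewrite Bool.xorb_nilpotent.
  - rewrite IH by (intros; (apply HS || apply H); lia).
    assert (H1 := H n (Nat.lt_succ_diag_r n)).
    assert (H2 := HS n ltac:(lia)). assert (H3 := HS (S n) ltac:(lia)).
    destruct (c n j), (c (S n) j); simpl in *; try tauto; destruct (is_W (c O j)); reflexivity.
Qed.

Lemma row_parity_no_N (c : nat -> nat -> quadrant) (j n : nat) :
  (forall i, (i <= n)%nat -> c i j <> qN) -> row_parity c j n = false.
Proof.
  induction n as [|n IH]; intros HN; simpl; [reflexivity|].
  rewrite IH by (intros; apply HN; lia).
  assert (H2 := HN n ltac:(lia)). assert (H3 := HN (S n) ltac:(lia)).
  destruct (c n j), (c (S n) j); simpl; congruence.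
Qed.

(** Otherwise all rows have the same parity, as the end columns are constantly W and E and
    contribute no edge. But row 0 avoids S and is odd, while row K avoids N and is even. *)
Lemma quadrant_grid (c : nat -> nat -> quadrant) (K : nat) :
  (forall j, (j <= K)%nat -> c O j = qW) -> (forall j, (j <= K)%nat -> c K j = qE) ->
  (forall i, (i <= K)%nat -> c i O <> qS) -> (forall i, (i <= K)%nat -> c i K <> qN) ->
  exists i j i' j',
    (i <= i' <= S i /\ j <= j' <= S j /\ i' <= K /\ j' <= K)%nat
    /\ opposite (c i j) (c i' j').
Proof.
  intros HW HE HS HN. apply NNPP; intros Hno.
  assert (Hc : forall i j i' j', (i <= i' <= S i /\ j <= j' <= S j /\ i' <= K /\ j' <= K)%nat ->
     ~ opposite (c i j) (c i' j')).
  { intros i j i' j' Hr Ho. apply Hno. now exists i, j, i', j'. }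
  assert (Hrow : forall j, (j <= K)%nat -> row_parity c j K = true).
  { induction j as [|j IH]; intros Hj.
    - rewrite row_parity_no_S, HW, HE by (auto; intros; apply Hc; lia). reflexivity.
    - assert (E := row_parity_succ c j K).
      rewrite IH in E by lia. rewrite !HW, !HE in E by lia. simpl in E.
      assert (E' := E ltac:(intros; repeat split; apply Hc; lia)).
      destruct (row_parity c (S j) K); [reflexivity|discriminate]. }
  assert (H1 := Hrow K (le_n K)). rewrite row_parity_no_N in H1 by auto. discriminate.
Qed.

(** The points are coloured by the sign of G2 beyond the threshold eps, and by the sign of G1 where
    G2 is small. A colour that the grid lemma forbids on the side x = 0 or x = 1 is itself a point
    of the second or third kind. *)
Lemma approximate_poincare_miranda (G1 G2 : R -> R -> R) (eps : R) :
  0 < eps ->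
  (exists del, 0 < del /\
     forall x y x' y', cc 0 1 x -> cc 0 1 y -> cc 0 1 x' -> cc 0 1 y' ->
     Rabs (x' - x) < del -> Rabs (y' - y) < del ->
     Rabs (G1 x' y' - G1 x y) < eps /\ Rabs (G2 x' y' - G2 x y) < eps) ->
  (forall x, cc 0 1 x -> G2 x 0 < - eps) ->
  (forall x, cc 0 1 x -> eps < G2 x 1) ->
  exists x y, cc 0 1 x /\ cc 0 1 y /\ Rabs (G2 x y) <= eps /\
    (Rabs (G1 x y) <= eps \/ (x = 0 /\ G1 x y <= 0) \/ (x = 1 /\ 0 <= G1 x y)).
Proof.
  intros Heps (del & Hdel & Huc) Hlo Hhi.
  apply NNPP; intros Hno.
  destruct (archimed_cor1 del Hdel) as (K & HK & HKpos).
  assert (HK0 : 0 < INR K) by (apply lt_0_INR; lia).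
  set (pt := fun i => INR i / INR K).
  assert (Hpt : forall i, (i <= K)%nat -> cc 0 1 (pt i)).
  { intros i Hi. unfold pt, cc. split.
    - apply Rdiv_le_0_compat; [apply pos_INR|assumption].
    - apply Rle_div_l; [assumption|]. rewrite Rmult_1_l. now apply le_INR. }
  assert (Hstep : forall i i', (i <= i' <= S i)%nat -> Rabs (pt i' - pt i) < del).
  { intros i i' Hi. unfold pt.
    replace (INR i' / INR K - INR i / INR K) with ((INR i' - INR i) * / INR K) by (field; lra).
    assert (0 <= INR i' - INR i <= 1).
    { split.
      - assert (INR i <= INR i') by (apply le_INR; lia). lra.
      - assert (INR i' <= INR (S i)) by (apply le_INR; lia). rewrite S_INR in H. lra. }
    assert (0 < / INR K) by now apply Rinv_0_lt_compat.
    rewrite Rabs_pos_eq by nra. nra. }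
  set (color := fun x y =>
     if Rlt_dec (G2 x y) (- eps) then qW
     else if Rlt_dec eps (G2 x y) then qE
     else if Rlt_dec 0 (G1 x y) then qN else qS).
  assert (Hcompat : forall x y x' y', cc 0 1 x -> cc 0 1 y -> cc 0 1 x' -> cc 0 1 y' ->
     Rabs (x' - x) < del -> Rabs (y' - y) < del ->
     ~ opposite (color x y) (color x' y')).
  (* W next to E would make G2 jump by more than 2 eps. N next to S makes G1 change sign within eps
     where G2 is small, which is a point of the first kind. *)
  { intros x y x' y' Hx Hy Hx' Hy' Hdx Hdy Hop.
    destruct (Huc x y x' y' Hx Hy Hx' Hy' Hdx Hdy) as [E1 E2].
    apply Rabs_lt_between in E1. apply Rabs_lt_between in E2.
    revert Hop. unfold color.
    repeat destruct Rlt_dec; simpl; try tauto; intros _; try lra;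
      apply Hno; exists x, y; repeat split; try apply Hx; try apply Hy;
      try (apply Rabs_le; lra); left; apply Rabs_le; lra. }
  (* The coordinates are exchanged: a row of the grid runs in the y direction, from W at y = 0 to E
     at y = 1. *)
  destruct (quadrant_grid (fun i j => color (pt j) (pt i)) K)
    as (i & j & i' & j' & (Hi & Hj & Hi' & Hj') & Hop).
  - intros j Hj. unfold color.
    replace (pt O) with 0 by (unfold pt; simpl; field; lra).
    specialize (Hlo _ (Hpt j Hj)). now destruct Rlt_dec.
  - intros j Hj. unfold color.
    replace (pt K) with 1 by (unfold pt; field; lra).
    specialize (Hhi _ (Hpt j Hj)). repeat destruct Rlt_dec; try reflexivity; lra.
  - intros i Hi Hc. apply Hno. exists (pt O), (pt i).
    revert Hc. unfold color. repeat destruct Rlt_dec; try discriminate. intros _.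
    split; [apply Hpt; lia|]. split; [now apply Hpt|].
    split; [apply Rabs_le; lra|]. right; left. split; [unfold pt; simpl; field; lra|lra].
  - intros i Hi Hc. apply Hno. exists (pt K), (pt i).
    revert Hc. unfold color. repeat destruct Rlt_dec; try discriminate. intros _.
    split; [apply Hpt; lia|]. split; [now apply Hpt|].
    split; [apply Rabs_le; lra|]. right; right. split; [unfold pt; field; lra|lra].
  - revert Hop. apply Hcompat; try (apply Hpt; lia); now apply Hstep.
Qed.

(** * Continuous functions and integrals on the line *)

Definition continuous_R (g : R -> R) : Prop := forall x, continuous g x.

Lemma ex_RInt_continuous_R (g : R -> R) (a b : R) : continuous_R g -> ex_RInt g a b.
Proof. intros H. apply (ex_RInt_continuous (V := R_CompleteNormedModule)). intros; apply H. Qed.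

Lemma continuous_R_id : continuous_R (fun x => x).
Proof. intros x. apply continuous_id. Qed.

Lemma continuous_R_const (c : R) : continuous_R (fun _ => c).
Proof. intros x. apply continuous_const. Qed.

Lemma continuous_R_plus (f g : R -> R) :
  continuous_R f -> continuous_R g -> continuous_R (fun x => f x + g x).
Proof. intros Hf Hg x. apply (continuous_plus f g); auto. Qed.

Lemma continuous_R_minus (f g : R -> R) :
  continuous_R f -> continuous_R g -> continuous_R (fun x => f x - g x).
Proof. intros Hf Hg x. apply (continuous_minus f g); auto. Qed.

Lemma continuous_R_mult (f g : R -> R) :
  continuous_R f -> continuous_R g -> continuous_R (fun x => f x * g x).
Proof. intros Hf Hg x. apply (continuous_mult f g); auto. Qed.

Lemma continuous_R_comp (f g : R -> R) :
  continuous_R f -> continuous_R g -> continuous_R (fun x => f (g x)).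
Proof. intros Hf Hg x. apply (continuous_comp g f); auto. Qed.

Lemma continuous_R_lipschitz (f : R -> R) (S : R) :
  (forall x y, Rabs (f x - f y) <= S * Rabs (x - y)) -> continuous_R f.
Proof.
  intros H x. apply filterlim_locally. intros eps.
  assert (HS : 0 < Rabs S + 1) by (generalize (Rabs_pos S); lra).
  assert (Hd : 0 < eps / (Rabs S + 1)) by (apply Rdiv_lt_0_compat; [apply cond_pos|assumption]).
  exists (mkposreal _ Hd). intros y Hy.
  unfold ball, AbsRing_ball, abs, minus, plus, opp in *; simpl in *.
  unfold AbsRing_ball, abs, minus, plus, opp in *; simpl in *.
  eapply Rle_lt_trans; [apply (H y x)|].
  assert (E : eps = (Rabs S + 1) * (eps / (Rabs S + 1)) :> R) by (field; lra).
  rewrite E. assert (Hab := Rle_abs S). assert (Hp := Rabs_pos (y - x)).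
  apply Rle_lt_trans with ((Rabs S + 1) * Rabs (y - x)); [nra|].
  apply Rmult_lt_compat_l; assumption.
Qed.

Definition clip (a b x : R) : R := Rmax a (Rmin b x).

Lemma clip_cc (a b x : R) : a <= b -> cc a b (clip a b x).
Proof. intros H. unfold cc, clip, Rmax, Rmin. repeat destruct Rle_dec; lra. Qed.

Lemma clip_id (a b x : R) : cc a b x -> clip a b x = x.
Proof. unfold cc, clip, Rmax, Rmin. repeat destruct Rle_dec; lra. Qed.

Lemma clip_nonexpansive (a b x y : R) :
  Rabs (clip a b x - clip a b y) <= Rabs (x - y).
Proof.
  unfold clip, Rmax, Rmin, Rabs. repeat destruct Rle_dec; repeat destruct Rcase_abs; lra.
Qed.

Lemma continuous_R_clip (a b : R) : continuous_R (clip a b).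
Proof.
  apply continuous_R_lipschitz with 1. intros x y. rewrite Rmult_1_l.
  apply clip_nonexpansive.
Qed.

(** Extension by constants turns continuity relative to an interval into continuity on the line, so
    that later integrals and compositions carry no side conditions. *)
Lemma continuous_on_comp_clip (D : R -> Prop) (f : R -> R) (a b : R) :
  a <= b -> (forall x, cc a b x -> D x) -> continuous_on D f ->
  continuous_R (fun x => f (clip a b x)).
Proof.
  intros Hab HD Hf x.
  apply filterlim_comp with (G := within D (locally (clip a b x))).
  - intros P HP. assert (HC := continuous_R_clip a b x _ HP).
    unfold filtermap in *. revert HC. apply filter_imp.
    intros y Hy. apply Hy. apply HD. now apply clip_cc.
  - apply Hf. apply HD. now apply clip_cc.
Qed.

Lemma comp_clip_bounded (g : R -> R) (a b : R) : a <= b ->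
  (forall x, cc a b x -> 0 <= g x) -> continuous_R (fun x => g (clip a b x)) ->
  exists M, 0 < M /\ forall x, 0 <= g (clip a b x) <= M.
Proof.
  intros Hab H0 Hc.
  destruct (continuous_ab_maj_consistent (fun x => g (clip a b x)) a b Hab
    (fun c _ => Hc c)) as (x0 & Hm & Hx0).
  exists (g (clip a b x0) + 1). assert (H1 := H0 _ (clip_cc a b x0 Hab)).
  split; [lra|]. intros x. split; [apply H0; now apply clip_cc|].
  specialize (Hm (clip a b x) (clip_cc a b x Hab)).
  rewrite (clip_id a b (clip a b x)) in Hm by now apply clip_cc. lra.
Qed.

Lemma comp_clip_uniformly_continuous (g : R -> R) (a b : R) : a <= b ->
  continuous_R (fun x => g (clip a b x)) ->
  forall eps, 0 < eps -> exists del, 0 < del /\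
    forall x y, Rabs (x - y) < del -> Rabs (g (clip a b x) - g (clip a b y)) < eps.
Proof.
  intros Hab Hc eps Heps.
  destruct (unifcont_normed_1d (fun x => g (clip a b x)) a b (fun x _ => Hc x)
    (mkposreal eps Heps)) as (del & Hdel).
  exists del. split; [apply cond_pos|]. intros x y Hxy.
  specialize (Hdel (clip a b y) (clip a b x) (clip_cc a b y Hab) (clip_cc a b x Hab)).
  rewrite !(clip_id a b (clip a b _)) in Hdel by now apply clip_cc.
  apply Hdel.
  apply Rle_lt_trans with (2 := Hxy). apply (clip_nonexpansive a b x y).
Qed.

Lemma Rabs_RInt_le_const (g : R -> R) (a b M : R) : continuous_R g ->
  (forall r, Rmin a b <= r <= Rmax a b -> Rabs (g r) <= M) ->
  Rabs (RInt g a b) <= Rabs (b - a) * M.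
Proof.
  intros Hg HM.
  apply (norm_RInt_le_const_abs (V := R_NormedModule) g a b (RInt g a b) M HM).
  apply (RInt_correct (V := R_CompleteNormedModule)). now apply ex_RInt_continuous_R.
Qed.

Lemma RInt_chasles_R (g : R -> R) (a b c : R) : continuous_R g ->
  RInt g a b + RInt g b c = RInt g a c.
Proof.
  intros Hg.
  apply (RInt_Chasles (V := R_CompleteNormedModule)); now apply ex_RInt_continuous_R.
Qed.

Lemma RInt_plus_R (g h : R -> R) (a b : R) : continuous_R g -> continuous_R h ->
  RInt (fun x => g x + h x) a b = RInt g a b + RInt h a b.
Proof.
  intros Hg Hh.
  apply (RInt_plus (V := R_CompleteNormedModule)); now apply ex_RInt_continuous_R.
Qed.

Lemma RInt_minus_R (g h : R -> R) (a b : R) : continuous_R g -> continuous_R h ->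
  RInt (fun x => g x - h x) a b = RInt g a b - RInt h a b.
Proof.
  intros Hg Hh.
  apply (RInt_minus (V := R_CompleteNormedModule)); now apply ex_RInt_continuous_R.
Qed.

Lemma RInt_scal_R (g : R -> R) (a b k : R) : continuous_R g ->
  RInt (fun x => k * g x) a b = k * RInt g a b.
Proof.
  intros Hg.
  apply (RInt_scal (V := R_CompleteNormedModule)); now apply ex_RInt_continuous_R.
Qed.

Lemma RInt_le_R (g h : R -> R) (a b : R) : a <= b -> continuous_R g -> continuous_R h ->
  (forall x, a <= x <= b -> g x <= h x) -> RInt g a b <= RInt h a b.
Proof.
  intros Hab Hg Hh H. apply RInt_le; try assumption; try now apply ex_RInt_continuous_R.
  intros x Hx. apply H. lra.
Qed.

Lemma RInt_affine (p q b : R) : RInt (fun t => p + q * t) 0 b = p * b + q * (b * b / 2).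
Proof.
  replace (p * b + q * (b * b / 2)) with
    (minus ((fun t => p * t + q * (t * t / 2)) b) ((fun t => p * t + q * (t * t / 2)) 0))
    by (unfold minus, plus, opp; simpl; lra).
  apply is_RInt_unique.
  apply (is_RInt_derive (V := R_CompleteNormedModule) (fun t => p * t + q * (t * t / 2)) (fun t => p + q * t)).
  - intros x _. auto_derive; [trivial|]. lra.
  - intros x _. apply continuous_R_plus; [apply continuous_R_const|].
    apply continuous_R_mult; [apply continuous_R_const|apply continuous_R_id].
Qed.

Lemma is_derive_RInt_R (y : R -> R) (a t : R) : continuous_R y ->
  is_derive (fun t => RInt y a t) t (y t).
Proof.
  intros Hy. apply (is_derive_RInt (V := R_NormedModule) y (fun t => RInt y a t) a t).
  - apply filter_forall. intros x.
    apply (RInt_correct (V := R_CompleteNormedModule)). now apply ex_RInt_continuous_R.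
  - apply Hy.
Qed.

(* The solution of v'' = y, v(0) = v'(0) = 0. *)
Definition iint (y : R -> R) (t : R) : R := RInt (fun r => (t - r) * y r) 0 t.

Lemma continuous_R_kernel (y : R -> R) (t : R) :
  continuous_R y -> continuous_R (fun r => (t - r) * y r).
Proof.
  intros Hy. apply continuous_R_mult; [|assumption].
  apply continuous_R_minus; [apply continuous_R_const|apply continuous_R_id].
Qed.

Lemma continuous_R_moment (y : R -> R) :
  continuous_R y -> continuous_R (fun r => r * y r).
Proof. intros Hy. apply continuous_R_mult; [apply continuous_R_id|assumption]. Qed.

(** Takes t out of the integrand, so that [iint] is differentiated by the product rule instead of
    under the integral sign. *)
Lemma iint_moments (y : R -> R) (t : R) : continuous_R y ->
  iint y t = t * RInt y 0 t - RInt (fun r => r * y r) 0 t.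
Proof.
  intros Hy. unfold iint.
  rewrite <- RInt_scal_R, <- RInt_minus_R; try assumption.
  - apply (RInt_ext (V := R_CompleteNormedModule)). intros; simpl; lra.
  - apply continuous_R_mult; [apply continuous_R_const|assumption].
  - now apply continuous_R_moment.
Qed.

Lemma is_derive_iint (y : R -> R) (t : R) : continuous_R y ->
  is_derive (iint y) t (RInt y 0 t).
Proof.
  intros Hy.
  apply is_derive_ext with (fun t => t * RInt y 0 t - RInt (fun r => r * y r) 0 t).
  { intros s. symmetry. now apply iint_moments. }
  assert (D1 := is_derive_RInt_R y 0 t Hy).
  assert (D2 := is_derive_RInt_R _ 0 t (continuous_R_moment y Hy)).
  assert (D3 : is_derive (fun t => t * RInt y 0 t) t (1 * RInt y 0 t + t * y t)).
  { apply (is_derive_mult (fun t => t) (fun t => RInt y 0 t)).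
    - apply (is_derive_id (K := R_AbsRing)).
    - assumption.
    - intros; apply Rmult_comm. }
  assert (D4 := is_derive_minus _ _ _ _ _ D3 D2).
  replace (RInt y 0 t) with
    (minus (1 * RInt y 0 t + t * y t) (t * y t)) by (unfold minus, plus, opp; simpl; lra).
  exact D4.
Qed.

Lemma continuous_R_iint (y : R -> R) : continuous_R y -> continuous_R (iint y).
Proof.
  intros Hy t. apply (ex_derive_continuous (K := R_AbsRing) (V := R_NormedModule)).
  exists (RInt y 0 t). now apply is_derive_iint.
Qed.

Lemma iint_0 (y : R -> R) : iint y 0 = 0.
Proof. unfold iint. apply (RInt_point (V := R_CompleteNormedModule)). Qed.

Lemma iint_close (y y' : R -> R) (T e t : R) : continuous_R y -> continuous_R y' ->
  0 <= e -> Rabs t <= T ->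
  (forall r, Rabs r <= Rabs t -> Rabs (y r - y' r) <= e) ->
  Rabs (iint y t - iint y' t) <= T * T * e.
Proof.
  intros Hy Hy' He Ht H. unfold iint.
  rewrite <- RInt_minus_R by now apply continuous_R_kernel.
  apply Rle_trans with (Rabs (t - 0) * (T * e)).
  - apply Rabs_RInt_le_const.
    + apply continuous_R_minus; now apply continuous_R_kernel.
    + intros r Hr.
      replace ((t - r) * y r - (t - r) * y' r) with ((t - r) * (y r - y' r)) by ring.
      rewrite Rabs_mult.
      assert (Rabs r <= Rabs t /\ Rabs (t - r) <= Rabs t).
      { revert Hr. unfold Rmin, Rmax, Rabs.
        repeat destruct Rle_dec; repeat destruct Rcase_abs; lra. }
      apply Rmult_le_compat; try apply Rabs_pos; [lra|]. now apply H.
  - rewrite Rminus_0_r, <- Rmult_assoc. apply Rmult_le_compat_r; [assumption|].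
    assert (Hp := Rabs_pos t). nra.
Qed.

(** The solution of u'' = -y with u(0) = p and u'(0) = q. Iterates, limits and the final solution
    all have this form, and they are concave because y is nonnegative. *)
Definition cap (p q : R) (y : R -> R) (t : R) : R := p + q * t - iint y t.

Lemma is_derive_cap (p q : R) (y : R -> R) (t : R) : continuous_R y ->
  is_derive (cap p q y) t (q - RInt y 0 t).
Proof.
  intros Hy. unfold cap.
  replace (q - RInt y 0 t) with (minus q (RInt y 0 t)) by reflexivity.
  apply (is_derive_minus (fun t => p + q * t) (iint y)).
  - auto_derive; [trivial|ring].
  - now apply is_derive_iint.
Qed.

Lemma continuous_R_cap (p q : R) (y : R -> R) : continuous_R y -> continuous_R (cap p q y).
Proof.
  intros Hy t. apply (ex_derive_continuous (K := R_AbsRing) (V := R_NormedModule)).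
  exists (q - RInt y 0 t). now apply is_derive_cap.
Qed.

Lemma cap_mean_value (p q : R) (y : R -> R) (a b : R) : continuous_R y -> a <= b ->
  exists c, a <= c <= b /\
    cap p q y b - cap p q y a = (q - RInt y 0 c) * (b - a).
Proof.
  intros Hy Hab.
  destruct (MVT_gen (cap p q y) a b (fun c => q - RInt y 0 c)) as (c & Hc & E).
  - intros x _. now apply is_derive_cap.
  - intros x _. apply continuity_pt_filterlim. now apply continuous_R_cap.
  - exists c. rewrite Rmin_left, Rmax_right in Hc by assumption. now split.
Qed.

(** The mean slopes over [a,b] and [b,c] are values of the derivative, which decreases since y >= 0.
    The chord inequality is multiplied out so that it also covers degenerate intervals. *)
Lemma cap_concave (p q : R) (y : R -> R) (a b c : R) : continuous_R y ->
  (forall r, 0 <= y r) -> a <= b <= c ->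
  (c - b) * cap p q y a + (b - a) * cap p q y c <= (c - a) * cap p q y b.
Proof.
  intros Hy H0 Habc.
  destruct (cap_mean_value p q y a b Hy ltac:(lra)) as (x1 & Hx1 & E1).
  destruct (cap_mean_value p q y b c Hy ltac:(lra)) as (x2 & Hx2 & E2).
  assert (E := RInt_chasles_R y 0 x1 x2 Hy).
  assert (Hpos : 0 <= RInt y x1 x2).
  { apply RInt_ge_0; [lra|now apply ex_RInt_continuous_R|auto]. }
  set (A := q - RInt y 0 x1) in *. set (B := q - RInt y 0 x2) in *.
  assert (B <= A) by (unfold A, B; lra).
  assert (0 <= (A - B) * ((b - a) * (c - b))) by (apply Rmult_le_pos; [lra|apply Rmult_le_pos; lra]).
  replace ((c - b) * cap p q y a) with ((c - b) * (cap p q y b - A * (b - a))) by (rewrite <- E1; ring).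
  replace ((b - a) * cap p q y c) with ((b - a) * (cap p q y b + B * (c - b))) by (rewrite <- E2; ring).
  nra.
Qed.

(** A convex function with value and slope 0 at 0 is nonnegative on both sides of 0. Negative t
    matter because shots run leftwards as well as rightwards. *)
Lemma iint_nonneg (y : R -> R) (t : R) : continuous_R y -> (forall r, 0 <= y r) ->
  0 <= iint y t.
Proof.
  intros Hy H0.
  assert (H : forall s, cap 0 0 y s = - iint y s) by (intros; unfold cap; ring).
  destruct (Rle_dec 0 t) as [Ht|Ht].
  - destruct (cap_mean_value 0 0 y 0 t Hy Ht) as (c & Hc & E).
    rewrite !H, iint_0 in E.
    assert (0 <= RInt y 0 c) by (apply RInt_ge_0; [lra|now apply ex_RInt_continuous_R|auto]).
    nra.
  - destruct (cap_mean_value 0 0 y t 0 Hy ltac:(lra)) as (c & Hc & E).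
    rewrite !H, iint_0 in E.
    assert (0 <= RInt y c 0) by (apply RInt_ge_0; [lra|now apply ex_RInt_continuous_R|auto]).
    assert (E' := RInt_chasles_R y 0 c 0 Hy).
    rewrite (RInt_point (V := R_CompleteNormedModule)) in E'. unfold zero in E'. simpl in E'.
    nra.
Qed.

(** A convex function vanishing at 0 lies below its chords from 0. *)
Lemma iint_star (y : R -> R) (b t : R) : continuous_R y -> (forall r, 0 <= y r) ->
  0 <= t <= b -> b * iint y t <= t * iint y b.
Proof.
  intros Hy H0 Ht.
  assert (H := cap_concave 0 0 y 0 t b Hy H0 ltac:(lra)).
  unfold cap in H. rewrite iint_0 in H. nra.
Qed.

Lemma cap_lipschitz (p q : R) (y : R -> R) (T Y a b : R) : continuous_R y ->
  (forall r, Rabs (y r) <= Y) -> cc (- T) T a -> cc (- T) T b ->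
  Rabs (cap p q y b - cap p q y a) <= (Rabs q + T * Y) * Rabs (b - a).
Proof.
  intros Hy HY Ha Hb. unfold cc in *.
  assert (Hgen : forall a b, a <= b -> - T <= a -> b <= T ->
    Rabs (cap p q y b - cap p q y a) <= (Rabs q + T * Y) * Rabs (b - a)).
  { clear a b Ha Hb. intros a b Hab Ha Hb.
    destruct (cap_mean_value p q y a b Hy Hab) as (c & Hc & E).
    rewrite E, Rabs_mult. apply Rmult_le_compat_r; [apply Rabs_pos|].
    apply Rle_trans with (1 := Rabs_triang q (- RInt y 0 c)). rewrite Rabs_Ropp.
    apply Rplus_le_compat_l.
    apply Rle_trans with (Rabs (c - 0) * Y).
    - apply Rabs_RInt_le_const; auto.
    - apply Rmult_le_compat_r.
      + apply Rle_trans with (2 := HY 0). apply Rabs_pos.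
      + rewrite Rminus_0_r. apply Rabs_le. lra. }
  destruct (Rle_dec a b).
  - apply Hgen; lra.
  - rewrite Rabs_minus_sym, (Rabs_minus_sym b a). apply Hgen; lra.
Qed.

(** Shots are described in time relative to the launching point c, the a priori estimates in time
    counted from 0. Moving the base point of the double integral only changes an affine function,
    which p and q absorb. *)
Lemma cap_shift (m s c : R) (y : R -> R) : continuous_R y ->
  exists p q, forall t, cap m s y (t - c) = cap p q (fun r => y (r - c)) t.
Proof.
  intros Hy.
  set (y' := fun r => y (r - c)).
  assert (Hsub : continuous_R (fun r => r - c)).
  { apply continuous_R_minus; [apply continuous_R_id|apply continuous_R_const]. }
  assert (Hy' : continuous_R y') by exact (continuous_R_comp y _ Hy Hsub).
  assert (E0 : forall (g : R -> R) t, continuous_R g ->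
     RInt (fun r => g (r - c)) 0 t = RInt g 0 (t - c) - RInt g 0 (0 - c)).
  { intros g t Hg.
    assert (E := RInt_comp_lin (V := R_CompleteNormedModule) g 1 (- c) 0 t
                  (ex_RInt_continuous_R g _ _ Hg)).
    assert (E1 := RInt_chasles_R g 0 (1 * 0 + - c) (1 * t + - c) Hg).
    replace (1 * 0 + - c) with (0 - c) in * by ring.
    replace (1 * t + - c) with (t - c) in * by ring.
    rewrite <- E in E1.
    rewrite (RInt_ext (V := R_CompleteNormedModule) _ (fun r => g (r - c)) 0 t) in E1.
    - lra.
    - intros x _. unfold scal; simpl. unfold mult; simpl. rewrite Rmult_1_l. f_equal. ring. }
  exists (m - s * c + RInt (fun r => r * y r) 0 (0 - c) + c * RInt y 0 (0 - c)
          ), (s - RInt y 0 (0 - c)).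
  intros t. unfold cap.
  rewrite (iint_moments y) by assumption.
  fold y'. rewrite (iint_moments y') by assumption.
  unfold y' at 1. rewrite E0 by assumption.
  assert (E2 : RInt (fun r => r * y' r) 0 t
     = RInt (fun r => r * y r) 0 (t - c) - RInt (fun r => r * y r) 0 (0 - c) + c * (RInt y 0 (t - c) - RInt y 0 (0 - c))).
  { rewrite <- (E0 y t Hy), <- (E0 _ t (continuous_R_moment y Hy)).
    rewrite <- RInt_scal_R by assumption. rewrite <- RInt_plus_R.
    - apply (RInt_ext (V := R_CompleteNormedModule)). intros x _. unfold y'. simpl. ring.
    - apply (continuous_R_comp (fun r => r * y r)); [now apply continuous_R_moment|assumption].
    - apply continuous_R_mult; [apply continuous_R_const|assumption]. }
  rewrite E2. ring.
Qed.

(** * A priori estimates for the boundary value problem *)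

(** Twice the determinant of the two boundary conditions, read as linear equations for p and q; the
    upper bound on beta makes it positive. *)
Definition bvp_det (T eta alpha beta : R) : R :=
  (2 * T - alpha * eta ^ 2) - beta * (alpha * eta ^ 2 - 2 * eta + 2 * T).

Lemma RInt_cap (p q b : R) (y : R -> R) : continuous_R y ->
  RInt (cap p q y) 0 b = p * b + q * (b * b / 2) - RInt (iint y) 0 b.
Proof.
  intros Hy. unfold cap. rewrite RInt_minus_R, RInt_affine.
  - reflexivity.
  - apply continuous_R_plus; [apply continuous_R_const|].
    apply continuous_R_mult; [apply continuous_R_const|apply continuous_R_id].
  - now apply continuous_R_iint.
Qed.

Lemma RInt_iint_star (y : R -> R) (b c : R) : continuous_R y -> (forall r, 0 <= y r) ->
  0 <= c <= b -> b * RInt (iint y) 0 c <= c * c / 2 * iint y b.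
Proof.
  intros Hy H0 Hc.
  rewrite <- RInt_scal_R by now apply continuous_R_iint.
  replace (c * c / 2 * iint y b) with (RInt (fun t => 0 + iint y b * t) 0 c)
    by (rewrite RInt_affine; lra).
  apply RInt_le_R; try lra.
  - apply continuous_R_mult; [apply continuous_R_const|now apply continuous_R_iint].
  - apply continuous_R_plus; [apply continuous_R_const|].
    apply continuous_R_mult; [apply continuous_R_const|apply continuous_R_id].
  - intros t Ht. assert (H := iint_star y b t Hy H0 ltac:(lra)). lra.
Qed.

(** A concave function lies above its chord. This is how the integral condition at T is turned into
    an inequality between u(0), u(eta) and u(T). *)
Lemma cap_trapezoid (p q b : R) (y : R -> R) : continuous_R y -> (forall r, 0 <= y r) ->
  0 < b -> b / 2 * (cap p q y 0 + cap p q y b) <= RInt (cap p q y) 0 b.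
Proof.
  intros Hy H0 Hb. rewrite RInt_cap by assumption.
  assert (H := RInt_iint_star y b b Hy H0 ltac:(lra)).
  unfold cap. rewrite iint_0.
  assert (RInt (iint y) 0 b <= b / 2 * iint y b) by nra.
  nra.
Qed.

Lemma RInt_iint_nonneg (y : R -> R) (b : R) : continuous_R y -> (forall r, 0 <= y r) ->
  0 <= b -> 0 <= RInt (iint y) 0 b.
Proof.
  intros Hy H0 Hb. apply RInt_ge_0; try assumption.
  - now apply ex_RInt_continuous_R, continuous_R_iint.
  - intros; now apply iint_nonneg.
Qed.

(** Cramer's rule, with [delta] the left defect. I, B and J stand for the double integral at eta, at
    T, and integrated over [0,eta]. *)
Lemma cap_coefficients (T eta alpha beta p q I B J delta : R) :
  p = beta * (p + q * eta - I) + delta ->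
  p + q * T - B = alpha * (p * eta + q * (eta * eta / 2) - J) ->
  bvp_det T eta alpha beta * p
    = (2 * T - alpha * eta ^ 2) * (delta - beta * I) + 2 * beta * eta * (B - alpha * J)
  /\ bvp_det T eta alpha beta * q
    = 2 * (1 - beta) * (B - alpha * J) - 2 * (1 - alpha * eta) * (delta - beta * I).
Proof.
  intros E1 E2.
  assert (E1' : delta - beta * I = p * (1 - beta) - q * beta * eta) by lra.
  assert (E2' : B - alpha * J
    = p * (1 - alpha * eta) + q * (T - alpha * (eta * eta / 2))) by lra.
  rewrite E1', E2'. unfold bvp_det. split; field.
Qed.

Lemma cap_upper (T eta alpha beta p q delta : R) (y : R -> R) :
  continuous_R y -> (forall r, 0 <= y r) ->
  0 < eta < T -> 0 < alpha -> 0 < 2 * T - alpha * eta ^ 2 -> 0 <= beta ->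
  delta <= 0 ->
  cap p q y 0 = beta * cap p q y eta + delta ->
  cap p q y T = alpha * RInt (cap p q y) 0 eta ->
  forall t, cc 0 T t ->
  bvp_det T eta alpha beta * cap p q y t
  <= iint y T * (2 * t + 4 * beta * eta + alpha * beta * eta ^ 2)
     - bvp_det T eta alpha beta * iint y t.
Proof.
  intros Hy H0 Heta Ha Ha2 Hb Hd E1 E2 t Ht. unfold cc in Ht.
  rewrite RInt_cap in E2 by assumption. unfold cap in *. rewrite iint_0 in E1.
  assert (HI := iint_nonneg y eta Hy H0).
  assert (HB := iint_nonneg y T Hy H0).
  assert (HJ := RInt_iint_nonneg y eta Hy H0 ltac:(lra)).
  assert (HIB := iint_star y T eta Hy H0 ltac:(lra)).
  assert (HJB := RInt_iint_star y T eta Hy H0 ltac:(lra)).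
  set (I := iint y eta) in *. set (B := iint y T) in *. set (J := RInt (iint y) 0 eta) in *.
  destruct (cap_coefficients T eta alpha beta p q I B J delta ltac:(lra) E2) as [Ep Eq].
  (* The coefficient of [delta] is affine in t and positive at both ends of [0,T]: there it equals 2
     T - alpha eta^2 and alpha eta (2 T - eta). *)
  assert (Hphi : 0 <= 2 * T - alpha * eta ^ 2 + 2 * t * (alpha * eta - 1)).
  { assert (0 <= (T - t) * (2 * T - alpha * eta ^ 2)) by (apply Rmult_le_pos; lra).
    assert (0 <= t * (alpha * eta * (2 * T - eta))).
    { apply Rmult_le_pos; [lra|]. apply Rmult_le_pos; [|lra]. apply Rmult_le_pos; lra. }
    nra. }
  assert (0 <= (- delta) * (2 * T - alpha * eta ^ 2 + 2 * t * (alpha * eta - 1)))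
    by (apply Rmult_le_pos; lra).
  assert (0 <= beta * I * (2 * T - alpha * eta ^ 2))
    by (apply Rmult_le_pos; [now apply Rmult_le_pos|lra]).
  assert (0 <= beta * t * B) by (repeat apply Rmult_le_pos; lra).
  assert (0 <= (t + beta * eta) * alpha * J).
  { assert (0 <= beta * eta) by (apply Rmult_le_pos; lra). repeat apply Rmult_le_pos; lra. }
  assert (0 <= beta * I * t * alpha * eta) by (repeat apply Rmult_le_pos; lra).
  assert (0 <= beta * alpha * ((T - t) * J)) by (repeat apply Rmult_le_pos; lra).
  assert (0 <= beta * ((T - t) * I)) by (repeat apply Rmult_le_pos; lra).
  assert (0 <= beta * alpha * (eta * eta / 2 * B - T * J))
    by (apply Rmult_le_pos; [apply Rmult_le_pos; lra|lra]).
  assert (0 <= beta * (eta * B - T * I)) by (apply Rmult_le_pos; lra).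
  replace (bvp_det T eta alpha beta * (p + q * t - iint y t)) with
    (bvp_det T eta alpha beta * p + t * (bvp_det T eta alpha beta * q)
     - bvp_det T eta alpha beta * iint y t) by ring.
  rewrite Ep, Eq.
  nra.
Qed.

(** At t = eta the parameter beta cancels: the right-hand side equals 2 eta B - 2 alpha eta J - (2 T
    - alpha eta^2) I plus a nonnegative multiple of [delta]. The part of B over [0,eta] pays for I,
    and the part over [eta,T] is left. *)
Lemma cap_eta_lower (T eta alpha beta p q delta : R) (y : R -> R) :
  continuous_R y -> (forall r, 0 <= y r) ->
  0 < eta < T -> 0 < alpha -> 0 <= delta ->
  cap p q y 0 = beta * cap p q y eta + delta ->
  cap p q y T = alpha * RInt (cap p q y) 0 eta ->
  2 * eta * RInt (fun s => (T - s) * y s) eta T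
  <= bvp_det T eta alpha beta * cap p q y eta.
Proof.
  intros Hy H0 Heta Ha Hd E1 E2.
  rewrite RInt_cap in E2 by assumption. unfold cap in *. rewrite iint_0 in E1.
  assert (HJI := RInt_iint_star y eta eta Hy H0 ltac:(lra)).
  assert (HB : iint y T = RInt (fun s => (T - s) * y s) 0 eta
                          + RInt (fun s => (T - s) * y s) eta T).
  { unfold iint. symmetry. apply RInt_chasles_R. now apply continuous_R_kernel. }
  (* Pointwise this is T (eta - s) <= eta (T - s), valid for s >= 0. *)
  assert (HI : T * iint y eta <= eta * RInt (fun s => (T - s) * y s) 0 eta).
  { unfold iint. rewrite <- !RInt_scal_R by now apply continuous_R_kernel.
    apply RInt_le_R; try lra;
      try (apply continuous_R_mult; [apply continuous_R_const|now apply continuous_R_kernel]).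
    intros s Hs. assert (0 <= s * (T - eta) * y s).
    { repeat apply Rmult_le_pos; try lra. apply H0. }
    nra. }
  set (I := iint y eta) in *. set (B := iint y T) in *. set (J := RInt (iint y) 0 eta) in *.
  set (P := RInt (fun s => (T - s) * y s) 0 eta) in *.
  set (Q := RInt (fun s => (T - s) * y s) eta T) in *.
  destruct (cap_coefficients T eta alpha beta p q I B J delta ltac:(lra) E2) as [Ep Eq].
  replace (bvp_det T eta alpha beta * (p + q * eta - I)) with
    (bvp_det T eta alpha beta * p + eta * (bvp_det T eta alpha beta * q)
     - bvp_det T eta alpha beta * I) by ring.
  rewrite Ep, Eq. unfold bvp_det.
  assert (0 <= alpha * (eta * eta / 2 * I - eta * J)) by (apply Rmult_le_pos; lra).
  assert (0 <= delta * (2 * (T - eta) + alpha * eta ^ 2)).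
  { apply Rmult_le_pos; [assumption|]. assert (0 <= alpha * eta ^ 2) by (apply Rmult_le_pos; nra). lra. }
  rewrite HB. nra.
Qed.

(** The trapezoid bound on u(T), concavity at eta and u(0) >= beta u(eta) combine to [bvp_det] times
    u(eta) >= 0. The signs at 0 and T follow from the boundary relations. *)
Lemma cap_nonneg (T eta alpha beta p q : R) (y : R -> R) :
  continuous_R y -> (forall r, 0 <= y r) ->
  0 < eta < T -> 0 < alpha -> 0 <= beta -> 0 < bvp_det T eta alpha beta ->
  beta * cap p q y eta <= cap p q y 0 ->
  cap p q y T = alpha * RInt (cap p q y) 0 eta ->
  0 <= cap p q y 0 /\ 0 <= cap p q y eta /\ 0 <= cap p q y T.
Proof.
  intros Hy H0 Heta Ha Hb HD E1 E2.
  assert (Htr := cap_trapezoid p q eta y Hy H0 ltac:(lra)).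
  assert (Hc := cap_concave p q y 0 eta T Hy H0 ltac:(lra)).
  set (u0 := cap p q y 0) in *. set (ue := cap p q y eta) in *. set (uT := cap p q y T) in *.
  assert (HT : alpha * (eta / 2 * (u0 + ue)) <= uT).
  { rewrite E2. apply Rmult_le_compat_l; lra. }
  assert (Hue : 0 <= ue).
  { assert (eta * (alpha * (eta / 2 * (u0 + ue))) <= eta * uT)
      by (apply Rmult_le_compat_l; lra).
    assert (K : 0 < alpha * eta ^ 2 / 2 + T - eta).
    { assert (0 < alpha * eta ^ 2) by (apply Rmult_lt_0_compat; nra). lra. }
    assert ((alpha * eta ^ 2 / 2 + T - eta) * (beta * ue)
            <= (alpha * eta ^ 2 / 2 + T - eta) * u0) by (apply Rmult_le_compat_l; lra).
    unfold bvp_det in HD.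
    assert (0 <= ((2 * T - alpha * eta ^ 2) - beta * (alpha * eta ^ 2 - 2 * eta + 2 * T)) * ue)
      by nra.
    apply Rnot_lt_le; intros Hneg. nra. }
  assert (0 <= beta * ue) by now apply Rmult_le_pos.
  assert (0 <= alpha * (eta / 2 * (u0 + ue))) by (repeat apply Rmult_le_pos; lra).
  lra.
Qed.

Lemma gamma_const_pos (T eta alpha beta : R) :
  0 < eta < T -> 0 < alpha -> 0 <= beta -> 0 < bvp_det T eta alpha beta ->
  0 < 2 * T - alpha * (beta + 1) * eta ^ 2 /\
  0 < gamma_const T eta alpha beta <= eta / T /\
  gamma_const T eta alpha beta <= alpha * (beta + 1) * eta ^ 2 / (2 * T) /\
  gamma_const T eta alpha beta
    <= alpha * (beta + 1) * eta * (T - eta) / (2 * T - alpha * (beta + 1) * eta ^ 2).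
Proof.
  intros Heta Ha Hb HD.
  (* This denominator equals [bvp_det] plus 2 beta (T - eta). *)
  assert (Hden : 0 < 2 * T - alpha * (beta + 1) * eta ^ 2).
  { unfold bvp_det in HD. assert (0 <= beta * (T - eta)) by (apply Rmult_le_pos; lra). nra. }
  assert (0 < alpha * (beta + 1)) by (apply Rmult_lt_0_compat; lra).
  assert (0 < alpha * (beta + 1) * eta ^ 2) by (apply Rmult_lt_0_compat; nra).
  split; [assumption|]. unfold gamma_const. split; [split|split].
  - repeat apply Rmin_glb_lt; apply Rdiv_lt_0_compat; try lra.
    repeat apply Rmult_lt_0_compat; lra.
  - apply Rmin_l.
  - eapply Rle_trans; [apply Rmin_r|apply Rmin_l].
  - eapply Rle_trans; [apply Rmin_r|apply Rmin_r].
Qed.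

(** By concavity it suffices to bound u at eta and T. If tau >= eta, the chord from 0 gives the
    factor eta / T at eta, and the trapezoid bound turns it into the second entry of the minimum at
    T. If tau < eta, then u(T) <= u(eta), and the chord through eta and T, extended back to tau,
    gives the third entry. *)
Lemma cap_gamma (T eta alpha beta p q tau : R) (y : R -> R) :
  continuous_R y -> (forall r, 0 <= y r) ->
  0 < eta < T -> 0 < alpha -> 0 <= beta -> 0 < bvp_det T eta alpha beta ->
  beta * cap p q y eta <= cap p q y 0 ->
  cap p q y T = alpha * RInt (cap p q y) 0 eta ->
  cc 0 T tau -> (forall t, cc 0 T t -> cap p q y t <= cap p q y tau) ->
  forall t, cc eta T t -> gamma_const T eta alpha beta * cap p q y tau <= cap p q y t.
Proof.
  intros Hy H0 Heta Ha Hb HD E1 E2 Htau Hmax t Ht. unfold cc in Htau, Ht.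
  destruct (cap_nonneg T eta alpha beta p q y Hy H0 Heta Ha Hb HD E1 E2) as (P0 & Pe & PT).
  destruct (gamma_const_pos T eta alpha beta Heta Ha Hb HD) as (Hden & [Hg0 Hg1] & Hg2 & Hg3).
  assert (Htr := cap_trapezoid p q eta y Hy H0 ltac:(lra)).
  assert (Hconc := fun a b c => cap_concave p q y a b c Hy H0).
  set (g := gamma_const T eta alpha beta) in *.
  set (u := cap p q y) in *.
  assert (Hm : 0 <= u tau).
  { apply Rle_trans with (1 := P0). apply Hmax. unfold cc; lra. }
  assert (HT : alpha * (beta + 1) * eta / 2 * u eta <= u T).
  { rewrite E2. apply Rle_trans with (alpha * (eta / 2 * (u 0 + u eta))).
    - assert (0 <= alpha * (eta / 2) * (u 0 - beta * u eta))
        by (apply Rmult_le_pos; [apply Rmult_le_pos|]; lra). nra.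
    - apply Rmult_le_compat_l; lra. }
  assert (HeT : g * u tau <= u eta /\ g * u tau <= u T).
  { destruct (Rle_dec eta tau) as [Hle|Hlt].
    - assert (He : eta / T * u tau <= u eta).
      { apply Rmult_le_reg_l with T; [lra|].
        replace (T * (eta / T * u tau)) with (eta * u tau) by (field; lra).
        assert (H := Hconc 0 eta tau ltac:(lra)).
        assert (0 <= (tau - eta) * u 0) by (apply Rmult_le_pos; lra).
        assert (0 <= (T - tau) * u eta) by (apply Rmult_le_pos; lra).
        lra. }
      split.
      + apply Rle_trans with (2 := He). apply Rmult_le_compat_r; lra.
      + apply Rle_trans with (2 := HT).
        apply Rle_trans with (alpha * (beta + 1) * eta / 2 * (eta / T * u tau)).
        * replace (alpha * (beta + 1) * eta / 2 * (eta / T * u tau)) with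
            (alpha * (beta + 1) * eta ^ 2 / (2 * T) * u tau) by (field; lra).
          apply Rmult_le_compat_r; lra.
        * apply Rmult_le_compat_l; [|assumption].
          assert (0 <= alpha * (beta + 1) * eta) by (repeat apply Rmult_le_pos; lra). lra.
    - assert (HTe : u T <= u eta).
      { assert (H := Hconc tau eta T ltac:(lra)).
        assert (u T <= u tau) by (apply Hmax; unfold cc; lra).
        assert (0 <= (T - eta) * (u tau - u T)) by (apply Rmult_le_pos; lra).
        assert ((T - tau) * u T <= (T - tau) * u eta) by lra.
        apply Rmult_le_reg_l with (T - tau); lra. }
      assert (HgT : g * u tau <= u T).
      { apply Rle_trans with
          (alpha * (beta + 1) * eta * (T - eta) / (2 * T - alpha * (beta + 1) * eta ^ 2) * u tau);
          [apply Rmult_le_compat_r; lra|].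
        apply Rmult_le_reg_l with (2 * T - alpha * (beta + 1) * eta ^ 2); [assumption|].
        replace ((2 * T - alpha * (beta + 1) * eta ^ 2) *
          (alpha * (beta + 1) * eta * (T - eta) / (2 * T - alpha * (beta + 1) * eta ^ 2) * u tau))
          with (alpha * (beta + 1) * eta * ((T - eta) * u tau)) by (field; lra).
        assert (H := Hconc tau eta T ltac:(lra)).
        assert (0 <= tau * (u eta - u T)) by (apply Rmult_le_pos; lra).
        assert (Hs : (T - eta) * u tau <= T * u eta - eta * u T) by lra.
        assert (0 <= alpha * (beta + 1) * eta) by (repeat apply Rmult_le_pos; lra).
        assert (alpha * (beta + 1) * eta * ((T - eta) * u tau)
                <= alpha * (beta + 1) * eta * (T * u eta - eta * u T))
          by (apply Rmult_le_compat_l; lra).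
        nra. }
      split; lra. }
  destruct HeT as [H1 H2].
  assert (H := Hconc eta t T ltac:(lra)).
  assert (0 <= (T - t) * (u eta - g * u tau)) by (apply Rmult_le_pos; lra).
  assert (0 <= (t - eta) * (u T - g * u tau)) by (apply Rmult_le_pos; lra).
  apply Rmult_le_reg_l with (T - eta); lra.
Qed.

Lemma cap_pos (T p q tau : R) (y : R -> R) :
  continuous_R y -> (forall r, 0 <= y r) ->
  0 <= cap p q y 0 -> 0 <= cap p q y T -> cc 0 T tau -> 0 < cap p q y tau ->
  (forall t, cc 0 T t -> 0 <= cap p q y t) /\ (forall t, 0 < t < T -> 0 < cap p q y t).
Proof.
  intros Hy H0 P0 PT Htau Pm. unfold cc in *.
  assert (Hconc := fun a b c => cap_concave p q y a b c Hy H0).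
  set (u := cap p q y) in *.
  assert (Hpos : forall t, 0 < t < T -> 0 < u t).
  { intros t Ht. destruct (Rtotal_order t tau) as [Hlt|[->|Hlt]]; [|assumption|].
    - assert (H := Hconc 0 t tau ltac:(lra)).
      assert (0 <= (tau - t) * u 0) by (apply Rmult_le_pos; lra).
      assert (0 < t * u tau) by (apply Rmult_lt_0_compat; lra).
      apply Rmult_lt_reg_l with tau; lra.
    - assert (H := Hconc tau t T ltac:(lra)).
      assert (0 <= (t - tau) * u T) by (apply Rmult_le_pos; lra).
      assert (0 < (T - t) * u tau) by (apply Rmult_lt_0_compat; lra).
      apply Rmult_lt_reg_l with (T - tau); lra. }
  split; [|assumption]. intros t Ht.
  destruct (Req_dec t 0) as [->|]; [assumption|].
  destruct (Req_dec t T) as [->|]; [assumption|].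
  left. apply Hpos. lra.
Qed.

(** * Delayed initial value problems *)

Definition uniformly_continuous_R (g : R -> R) : Prop :=
  forall eps, 0 < eps -> exists del, 0 < del /\
    forall x y, Rabs (x - y) < del -> Rabs (g x - g y) < eps.

(** Soft thresholding: r moves towards 0 by h, and becomes 0 if its modulus is at most h. *)
Definition delay (h r : R) : R := r - clip (- h) h r.

Lemma continuous_R_delay (h : R) : continuous_R (delay h).
Proof. apply continuous_R_minus; [apply continuous_R_id|apply continuous_R_clip]. Qed.

Lemma delay_near (h r : R) : 0 <= h -> Rabs (delay h r - r) <= h.
Proof.
  intros Hh. unfold delay. assert (H := clip_cc (- h) h r ltac:(lra)). unfold cc in H.
  apply Rabs_le. lra.
Qed.

Lemma delay_le (h r b : R) : 0 <= h -> 0 <= b -> Rabs r <= b + h -> Rabs (delay h r) <= b.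
Proof.
  intros Hh Hb. unfold delay, clip, Rmax, Rmin, Rabs.
  repeat destruct Rle_dec; repeat destruct Rcase_abs; lra.
Qed.

Lemma delay_shrinks (h r : R) : 0 <= h -> Rabs (delay h r) <= Rabs r.
Proof. intros Hh. apply delay_le; [assumption|apply Rabs_pos|lra]. Qed.

(* Tonelli's scheme, run outwards from 0 in both directions: the right-hand side
   only looks at values which are closer to 0 by [h], so that the iterates become
   stationary on [-k h, k h] after [k] steps. *)
Fixpoint tonelli (A F : R -> R) (h m s : R) (k : nat) : R -> R :=
  match k with
  | O => fun _ => m
  | S k => cap m s (fun r => A r * F (tonelli A F h m s k (delay h r)))
  end.

Lemma continuous_R_tonelli (A F : R -> R) (h m s : R) (k : nat) :
  continuous_R A -> continuous_R F ->
  continuous_R (tonelli A F h m s k) /\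
  continuous_R (fun r => A r * F (tonelli A F h m s k (delay h r))).
Proof.
  intros HA HF.
  assert (Hsource : forall w, continuous_R w -> continuous_R (fun r => A r * F (w (delay h r)))).
  { intros w Hw. apply continuous_R_mult; [assumption|]. apply continuous_R_comp; [assumption|].
    apply continuous_R_comp; [assumption|apply continuous_R_delay]. }
  induction k as [|k [_ IH]].
  - split; [|apply Hsource]; apply continuous_R_const.
  - split; [|apply Hsource]; now apply continuous_R_cap.
Qed.

(** Once k h >= T, iterate k + 1 therefore solves the delayed equation on [-T,T]. *)
Lemma tonelli_stationary (A F : R -> R) (h m s : R) (k : nat) :
  0 <= h -> forall tau, Rabs tau <= INR k * h ->
  tonelli A F h m s (S k) tau = tonelli A F h m s k tau.
Proof.
  intros Hh. induction k as [|k IH]; intros tau Htau.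
  - simpl in Htau. assert (tau = 0) as ->.
    { destruct (Req_dec tau 0) as [|Hn]; [assumption|].
      apply Rabs_pos_lt in Hn. lra. }
    simpl. unfold cap. rewrite iint_0. ring.
  - change (cap m s (fun r => A r * F (tonelli A F h m s (S k) (delay h r))) tau
            = cap m s (fun r => A r * F (tonelli A F h m s k (delay h r))) tau).
    unfold cap, iint. f_equal.
    apply (RInt_ext (V := R_CompleteNormedModule)). intros r Hr.
    rewrite S_INR in Htau. rewrite IH; [reflexivity|].
    apply delay_le; [assumption|apply Rmult_le_pos; [apply pos_INR|assumption]|].
    revert Hr Htau. generalize (INR k). intros K.
    unfold Rmin, Rmax, Rabs. repeat destruct Rle_dec; repeat destruct Rcase_abs; lra.
Qed.

(** Joint continuity of one integration step in its parameters and in the function fed into F. It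
    serves twice: for the continuity of the iterates and for the passage to the limit in the delayed
    equation. *)
Lemma cap_source_close (a F : R -> R) (T aM FM : R) :
  0 <= T -> 0 < aM -> 0 < FM -> continuous_R a -> continuous_R F ->
  (forall x, 0 <= a x <= aM) -> (forall x, 0 <= F x <= FM) ->
  uniformly_continuous_R a -> uniformly_continuous_R F ->
  forall eps, 0 < eps -> exists del, 0 < del /\
  forall m m' s s' c c' w w', Rabs (m - m') < del -> Rabs (s - s') < del ->
  Rabs (c - c') < del -> continuous_R w -> continuous_R w' ->
  (forall r, Rabs r <= T -> Rabs (w r - w' r) < del) ->
  forall tau, Rabs tau <= T ->
  Rabs (cap m s (fun r => a (c + r) * F (w r)) tau
        - cap m' s' (fun r => a (c' + r) * F (w' r)) tau) < eps.
Proof.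
  intros HT HaM HFM Hac HFc Ha HF Hau HFu eps Heps.
  assert (Hsh : forall c w, continuous_R w -> continuous_R (fun r => a (c + r) * F (w r))).
  { intros c w Hw. apply continuous_R_mult; apply continuous_R_comp; try assumption.
    apply continuous_R_plus; [apply continuous_R_const|apply continuous_R_id]. }
  set (e := eps / (4 * (T * T + 1))).
  assert (He : 0 < e) by (apply Rdiv_lt_0_compat; nra).
  assert (Hee : T * T * e <= eps / 4).
  { replace (eps / 4) with ((T * T + 1) * e) by (unfold e; field; nra). nra. }
  destruct (HFu (e / (2 * aM)) ltac:(apply Rdiv_lt_0_compat; lra)) as (dF & HdF & HF').
  destruct (Hau (e / (2 * FM)) ltac:(apply Rdiv_lt_0_compat; lra)) as (da & Hda & Ha').
  set (ds := eps / (4 * (T + 1))).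
  assert (Hds : 0 < ds) by (apply Rdiv_lt_0_compat; lra).
  assert (Hds' : T * ds <= eps / 4).
  { replace (eps / 4) with ((T + 1) * ds) by (unfold ds; field; lra). nra. }
  exists (Rmin (Rmin (eps / 4) ds) (Rmin dF da)).
  split; [repeat apply Rmin_glb_lt; lra|].
  intros m m' s s' c c' w w' Hm Hs Hc Hw Hw' Hww tau Htau.
  assert (Hmin : forall x, x < Rmin (Rmin (eps / 4) ds) (Rmin dF da) ->
     x < eps / 4 /\ x < ds /\ x < dF /\ x < da).
  { intros x. unfold Rmin. repeat destruct Rle_dec; lra. }
  destruct (Hmin _ Hm) as (Hm1 & _). destruct (Hmin _ Hs) as (_ & Hs2 & _).
  destruct (Hmin _ Hc) as (_ & _ & _ & Hc4).
  unfold cap.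
  assert (Hi : Rabs (iint (fun r => a (c + r) * F (w r)) tau
                     - iint (fun r => a (c' + r) * F (w' r)) tau) <= T * T * e).
  { apply iint_close; auto; [lra|].
    intros r Hr.
    assert (HFr : Rabs (F (w r) - F (w' r)) < e / (2 * aM)).
    { apply HF'. now destruct (Hmin _ (Hww r ltac:(lra))) as (_ & _ & H & _). }
    assert (Har : Rabs (a (c + r) - a (c' + r)) < e / (2 * FM)).
    { apply Ha'. now replace (c + r - (c' + r)) with (c - c') by ring. }
    replace (a (c + r) * F (w r) - a (c' + r) * F (w' r)) with
      (a (c + r) * (F (w r) - F (w' r)) + F (w' r) * (a (c + r) - a (c' + r))) by ring.
    apply Rle_trans with (1 := Rabs_triang _ _). rewrite !Rabs_mult.
    rewrite (Rabs_pos_eq (a (c + r))) by apply Ha.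
    rewrite (Rabs_pos_eq (F (w' r))) by apply HF.
    replace e with (aM * (e / (2 * aM)) + FM * (e / (2 * FM))) by (field; lra).
    apply Rplus_le_compat; apply Rmult_le_compat; try apply Rabs_pos;
      try apply Ha; try apply HF; lra. }
  assert (Hst : Rabs ((s - s') * tau) <= T * ds).
  { rewrite Rabs_mult, Rmult_comm. apply Rmult_le_compat; try apply Rabs_pos; lra. }
  apply Rabs_le_between in Hi. apply Rabs_le_between in Hst.
  apply Rabs_lt_between in Hm1. apply Rabs_lt_between. lra.
Qed.

Lemma continuous_R_shift (a : R -> R) (c : R) :
  continuous_R a -> continuous_R (fun r => a (c + r)).
Proof.
  intros Ha. apply continuous_R_comp; [assumption|].
  apply continuous_R_plus; [apply continuous_R_const|apply continuous_R_id].
Qed.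

Lemma continuous_R_tonelli_delay (A F : R -> R) (h m s : R) (k : nat) :
  continuous_R A -> continuous_R F ->
  continuous_R (fun r => tonelli A F h m s k (delay h r)).
Proof.
  intros HA HF. apply (continuous_R_comp (tonelli A F h m s k)).
  - now apply continuous_R_tonelli.
  - apply continuous_R_delay.
Qed.

(** F has a modulus of continuity but no Lipschitz constant, so each iteration composes moduli and
    [del] depends on k. This is harmless because the continuity is used at a fixed delay only. *)
Lemma tonelli_uniformly_continuous (a F : R -> R) (T h aM FM : R) (k : nat) :
  0 <= T -> 0 <= h -> 0 < aM -> 0 < FM -> continuous_R a -> continuous_R F ->
  (forall x, 0 <= a x <= aM) -> (forall x, 0 <= F x <= FM) ->
  uniformly_continuous_R a -> uniformly_continuous_R F ->
  forall eps, 0 < eps -> exists del, 0 < del /\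
  forall m m' s s' c c', Rabs (m - m') < del -> Rabs (s - s') < del -> Rabs (c - c') < del ->
  forall tau, Rabs tau <= T ->
  Rabs (tonelli (fun r => a (c + r)) F h m s k tau
        - tonelli (fun r => a (c' + r)) F h m' s' k tau) < eps.
Proof.
  intros HT Hh HaM HFM Hac HFc Ha HF Hau HFu.
  induction k as [|k IH]; intros eps Heps.
  - exists eps. split; [assumption|]. intros. simpl. assumption.
  - destruct (cap_source_close a F T aM FM HT HaM HFM Hac HFc Ha HF Hau HFu eps Heps)
      as (d & Hd & Hclose).
    destruct (IH d Hd) as (dk & Hdk & IH').
    exists (Rmin d dk). split; [now apply Rmin_glb_lt|].
    intros m m' s s' c c' Hm Hs Hc tau Htau.
    assert (Hmin : forall x, x < Rmin d dk -> x < d /\ x < dk).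
    { intros x. unfold Rmin. destruct Rle_dec; lra. }
    apply Hmin in Hm, Hs, Hc. simpl.
    apply Hclose; try tauto;
      try (apply continuous_R_tonelli_delay; [now apply continuous_R_shift|assumption]).
    intros r Hr. apply IH'; try tauto.
    apply Rle_trans with (Rabs r); [now apply delay_shrinks|assumption].
Qed.

(** * Arzela-Ascoli theorem *)

Definition strictly_increasing (phi : nat -> nat) : Prop :=
  forall n, (phi n < phi (S n))%nat.

Lemma strictly_increasing_ge_id (phi : nat -> nat) :
  strictly_increasing phi -> forall n, (n <= phi n)%nat.
Proof.
  intros H. induction n as [|n IH]; [lia|]. specialize (H n). lia.
Qed.

Lemma strictly_increasing_lt (phi : nat -> nat) : strictly_increasing phi ->
  forall n p, (n < p)%nat -> (phi n < phi p)%nat.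
Proof.
  intros H n p Hnp. induction Hnp as [|p _ IH]; [apply H|]. specialize (H p). lia.
Qed.

Lemma strictly_increasing_comp (phi psi : nat -> nat) :
  strictly_increasing phi -> strictly_increasing psi ->
  strictly_increasing (fun n => phi (psi n)).
Proof. intros H1 H2 n. now apply strictly_increasing_lt. Qed.

Lemma bounded_subsequence (v : nat -> R) (B : R) : (forall n, Rabs (v n) <= B) ->
  exists phi l, strictly_increasing phi /\ is_lim_seq (fun n => v (phi n)) (Finite l).
Proof.
  intros HB.
  destruct (Bolzano_Weierstrass v (fun x => - B <= x <= B) (compact_P3 (- B) B)) as (l & Hl).
  { intros n. now apply Rabs_le_between. }
  assert (Hnext : forall k N : nat, exists p, (N <= p)%nat /\ Rabs (v p - l) < / (INR k + 1)).
  { intros k N.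
    assert (Hk : 0 < / (INR k + 1)) by (apply Rinv_0_lt_compat; generalize (pos_INR k); lra).
    destruct (Hl (disc l (mkposreal _ Hk)) N) as (p & Hp & Hd).
    - exists (mkposreal _ Hk). now intros x Hx.
    - exists p. now split. }
  set (next := fun k N => proj1_sig (constructive_indefinite_description _ (Hnext k N))).
  assert (Hn : forall k N, (N <= next k N)%nat /\ Rabs (v (next k N) - l) < / (INR k + 1)).
  { intros k N. exact (proj2_sig (constructive_indefinite_description _ (Hnext k N))). }
  set (phi := fix phi n := match n with O => next O O | S k => next (S k) (S (phi k)) end).
  exists phi, l. split.
  - intros n. simpl. exact (proj1 (Hn (S n) (S (phi n)))).
  - apply is_lim_seq_spec. intros eps. simpl.
    destruct (archimed_cor1 eps (cond_pos eps)) as (K & HK & HK0).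
    exists K. intros n Hle.
    assert (Hphi : Rabs (v (phi n) - l) < / (INR n + 1)) by (destruct n; apply Hn).
    apply Rlt_trans with (1 := Hphi).
    apply Rle_lt_trans with (2 := HK). apply Rinv_le_contravar.
    + apply lt_0_INR; lia.
    + apply le_INR in Hle. lra.
Qed.

Lemma diagonal_subsequence (v : nat -> nat -> R) (B : nat -> R) :
  (forall k n, Rabs (v k n) <= B k) ->
  exists phi, strictly_increasing phi /\
    forall k, exists l, is_lim_seq (fun n => v k (phi n)) (Finite l).
Proof.
  intros HB.
  (* Boundedness is a premise of convergence only, so that choice yields a function [sel] of the
     sequence alone. *)
  assert (Hsel : forall w : nat -> R, exists phi, strictly_increasing phi /\
    ((exists M, forall n, Rabs (w n) <= M) ->
     exists l, is_lim_seq (fun n => w (phi n)) (Finite l))).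
  { intros w. destruct (classic (exists M, forall n, Rabs (w n) <= M)) as [(M & HM)|Hno].
    - destruct (bounded_subsequence w M HM) as (phi & l & H1 & H2).
      exists phi. split; [assumption|]. intros _. now exists l.
    - exists (fun n => n). split; [intros n; lia|tauto]. }
  set (sel := fun w => proj1_sig (constructive_indefinite_description _ (Hsel w))).
  assert (Hs : forall w, strictly_increasing (sel w) /\
    ((exists M, forall n, Rabs (w n) <= M) ->
     exists l, is_lim_seq (fun n => w (sel w n)) (Finite l))).
  { intros w. exact (proj2_sig (constructive_indefinite_description _ (Hsel w))). }
  set (Phi := fix Phi k := match k with
    | O => sel (v O)
    | S k => fun n => Phi k (sel (fun i => v (S k) (Phi k i)) n) end).
  assert (Hinc : forall k, strictly_increasing (Phi k)).
  { induction k as [|k IH]; [apply Hs|].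
    apply (strictly_increasing_comp (Phi k)); [assumption|apply Hs]. }
  assert (Hlim : forall k, exists l, is_lim_seq (fun n => v k (Phi k n)) (Finite l)).
  { intros [|k].
    - apply (Hs (v O)). exists (B O). intros; apply HB.
    - apply (Hs (fun i => v (S k) (Phi k i))). exists (B (S k)). intros; apply HB. }
  (* From index k on, the diagonal runs through values of [Phi k] at arguments at least n, so it
     inherits that limit. *)
  assert (Hsub : forall k d n, exists j, (n <= j)%nat /\ Phi (d + k)%nat n = Phi k j).
  { intros k. induction d as [|d IH]; intros n; [now exists n|].
    destruct (IH (sel (fun i => v (S (d + k)) (Phi (d + k)%nat i)) n)) as (j & Hj & E).
    exists j. split; [|exact E].
    apply Nat.le_trans with (2 := Hj). apply strictly_increasing_ge_id. apply Hs. }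
  exists (fun n => Phi n n). split.
  - intros n. simpl. apply strictly_increasing_lt; [apply Hinc|].
    apply (Nat.lt_le_trans _ (S n)); [lia|]. apply strictly_increasing_ge_id. apply Hs.
  - intros k. destruct (Hlim k) as (l & Hl). exists l.
    apply is_lim_seq_spec in Hl. apply is_lim_seq_spec.
    intros eps. destruct (Hl eps) as (N & HN). exists (max N k). intros n Hn. simpl.
    destruct (Hsub k (n - k)%nat n) as (j & Hj & E).
    replace (n - k + k)%nat with n in E by lia. rewrite E. apply HN. lia.
Qed.

Lemma finite_eventually (P : nat -> nat -> Prop) (M : nat) :
  (forall i, exists N, forall n, (N <= n)%nat -> P i n) ->
  exists N, forall i n, (i <= M)%nat -> (N <= n)%nat -> P i n.
Proof.
  intros H. induction M as [|M (N1 & IH)].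
  - destruct (H O) as (N & HN). exists N. intros i n Hi Hn.
    replace i with O by lia. now apply HN.
  - destruct (H (S M)) as (N2 & HN). exists (max N1 N2). intros i n Hi Hn.
    destruct (Nat.eq_dec i (S M)) as [->|].
    + apply HN. lia.
    + apply IH; lia.
Qed.

(** The diagonal argument runs over all points [grid i j], enumerated by Cantor pairing. For large i
    they lie outside [-T,T]; this is why the Lipschitz bound is assumed on the whole line. *)
Lemma arzela (v : nat -> R -> R) (T S B : R) : 0 < T -> 0 <= S ->
  (forall n x y, Rabs (v n x - v n y) <= S * Rabs (x - y)) ->
  (forall n, Rabs (v n 0) <= B) ->
  exists phi z, strictly_increasing phi /\
    (forall x y, cc (- T) T x -> cc (- T) T y -> Rabs (z x - z y) <= S * Rabs (x - y)) /\
    forall eps, 0 < eps -> exists N, forall n, (N <= n)%nat ->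
      forall x, cc (- T) T x -> Rabs (v (phi n) x - z x) <= eps.
Proof.
  intros HT HS Hlip HB.
  set (grid := fun i j => - T + 2 * T * (INR i / (INR j + 1))).
  set (q := fun k => grid (fst (Cantor.of_nat k)) (snd (Cantor.of_nat k))).
  destruct (diagonal_subsequence (fun k n => v n (q k)) (fun k => B + S * Rabs (q k)))
    as (phi & Hphi & Hconv).
  { intros k n. replace (v n (q k)) with (v n 0 + (v n (q k) - v n 0)) by ring.
    apply Rle_trans with (1 := Rabs_triang _ _). apply Rplus_le_compat; [apply HB|].
    apply Rle_trans with (1 := Hlip n (q k) 0). rewrite Rminus_0_r. apply Rle_refl. }
  assert (Hcauchy : forall eps, 0 < eps -> exists N, forall n p, (N <= n)%nat -> (N <= p)%nat ->
    forall x, cc (- T) T x -> Rabs (v (phi n) x - v (phi p) x) <= eps).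
  { intros eps Heps.
    (* The mesh 2 T / (j + 1) costs at most eps / 4 for each of two moves to a grid point, and the
       Cauchy error there at most eps / 4. *)
    assert (Hd : 0 < eps / (8 * T * (S + 1))) by (apply Rdiv_lt_0_compat; nra).
    destruct (archimed_cor1 _ Hd) as (j & Hj & Hj0).
    assert (Hj1 : 0 < INR j) by (apply lt_0_INR; lia).
    assert (Hcoarse : S * (2 * T / (INR j + 1)) <= eps / 4).
    { apply Rle_trans with ((S + 1) * (2 * T * / INR j)).
      - apply Rmult_le_compat; try lra.
        + apply Rdiv_le_0_compat; lra.
        + apply Rmult_le_compat_l; [lra|]. apply Rinv_le_contravar; lra.
      - replace (eps / 4) with ((S + 1) * (2 * T * (eps / (8 * T * (S + 1))))) by (field; lra).
        apply Rmult_le_compat_l; [lra|]. apply Rmult_le_compat_l; lra. }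
    destruct (finite_eventually (fun i n => forall p, (n <= p)%nat ->
        Rabs (v (phi n) (grid i j) - v (phi p) (grid i j)) <= eps / 4) (Datatypes.S j))
      as (N & HN).
    { intros i. destruct (Hconv (Cantor.to_nat (i, j))) as (l & Hl).
      assert (Hq : q (Cantor.to_nat (i, j)) = grid i j)
        by (unfold q; now rewrite Cantor.cancel_of_to).
      rewrite Hq in Hl. apply is_lim_seq_spec in Hl.
      assert (He : 0 < eps / 8) by lra.
      destruct (Hl (mkposreal _ He)) as (N & HN). simpl in HN.
      exists N. intros n Hn p Hp.
      assert (H1 := HN n Hn). assert (H2 := HN p ltac:(lia)).
      apply Rabs_lt_between in H1. apply Rabs_lt_between in H2. apply Rabs_le. lra. }
    exists N.
    assert (Hhalf : forall n p, (N <= n)%nat -> (n <= p)%nat ->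
      forall x, cc (- T) T x -> Rabs (v (phi n) x - v (phi p) x) <= eps).
    { intros n p Hn Hp x Hx. unfold cc in Hx.
      destruct (nfloor_ex ((x + T) / (2 * T) * (INR j + 1))) as (i & Hi1 & Hi2).
      { apply Rmult_le_pos; [apply Rdiv_le_0_compat; lra|lra]. }
      assert (Hij : (i <= Datatypes.S j)%nat).
      { apply INR_le. rewrite S_INR. apply Rle_trans with (1 := Hi1).
        rewrite <- (Rmult_1_l (INR j + 1)) at 2. apply Rmult_le_compat_r; [lra|].
        apply Rle_div_l; lra. }
      assert (Hg : Rabs (x - grid i j) <= 2 * T / (INR j + 1)).
      { unfold grid.
        replace (x - (- T + 2 * T * (INR i / (INR j + 1)))) with
          (2 * T / (INR j + 1) * ((x + T) / (2 * T) * (INR j + 1) - INR i)) by (field; lra).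
        rewrite Rabs_mult, Rabs_pos_eq by (apply Rdiv_le_0_compat; lra).
        rewrite <- (Rmult_1_r (2 * T / (INR j + 1))) at 2.
        apply Rmult_le_compat_l; [apply Rdiv_le_0_compat; lra|]. apply Rabs_le. lra. }
      assert (Hs : S * Rabs (x - grid i j) <= eps / 4).
      { apply Rle_trans with (2 := Hcoarse). now apply Rmult_le_compat_l. }
      assert (H1 := Hlip (phi n) x (grid i j)). assert (H2 := Hlip (phi p) x (grid i j)).
      assert (H3 := HN i n Hij Hn p Hp).
      assert (H1' := Rle_trans _ _ _ H1 Hs). assert (H2' := Rle_trans _ _ _ H2 Hs).
      apply Rabs_le_between in H1'. apply Rabs_le_between in H2'. apply Rabs_le_between in H3.
      apply Rabs_le. lra. }
    intros n p Hn Hp x Hx. destruct (Nat.le_ge_cases n p).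
    - now apply Hhalf.
    - rewrite Rabs_minus_sym. now apply Hhalf. }
  assert (Hlim : forall x, cc (- T) T x ->
    is_lim_seq (fun n => v (phi n) x) (Finite (real (Lim_seq (fun n => v (phi n) x))))).
  { intros x Hx. apply Lim_seq_correct'. apply ex_lim_seq_cauchy_corr. intros eps.
    assert (He : 0 < eps / 2) by (generalize (cond_pos eps); lra).
    destruct (Hcauchy _ He) as (N & HN). exists N. intros n p Hn Hp.
    apply Rle_lt_trans with (1 := HN n p Hn Hp x Hx). generalize (cond_pos eps); lra. }
  exists phi, (fun x => real (Lim_seq (fun n => v (phi n) x))).
  split; [assumption|]. split.
  - intros x y Hx Hy.
    apply (is_lim_seq_le (fun n => Rabs (v (phi n) x - v (phi n) y)) (fun _ => S * Rabs (x - y))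
      (Finite (Rabs (real (Lim_seq (fun n => v (phi n) x)) - real (Lim_seq (fun n => v (phi n) y)))))
      (Finite (S * Rabs (x - y)))).
    + intros n. apply Hlip.
    + apply (is_lim_seq_abs _ (Finite _)). apply is_lim_seq_minus'; now apply Hlim.
    + apply is_lim_seq_const.
  - intros eps Heps. destruct (Hcauchy eps Heps) as (N & HN).
    exists N. intros n Hn x Hx.
    apply (is_lim_seq_le_loc (fun p => Rabs (v (phi n) x - v (phi p) x)) (fun _ => eps)
      (Finite (Rabs (v (phi n) x - real (Lim_seq (fun n => v (phi n) x)))))
      (Finite eps)).
    + exists N. intros p Hp. now apply HN.
    + apply (is_lim_seq_abs _ (Finite _)). apply is_lim_seq_minus'; [apply is_lim_seq_const|now apply Hlim].
    + apply is_lim_seq_const.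
Qed.

Lemma is_lim_seq_eventually_close (u : nat -> R) (l eps : R) :
  is_lim_seq u (Finite l) -> 0 < eps ->
  exists N, forall n, (N <= n)%nat -> Rabs (u n - l) < eps.
Proof.
  intros H Heps. apply is_lim_seq_spec in H.
  destruct (H (mkposreal eps Heps)) as (N & HN). now exists N.
Qed.

Lemma Rabs_le_cc (T x : R) : Rabs x <= T <-> cc (- T) T x.
Proof. apply Rabs_le_between. Qed.

(** All iterates share the Lipschitz constant L + T aM FM, whatever their number and delay. The
    source y of the limit is defined on the line by freezing the limit function outside [-T,T]. *)
Lemma tonelli_limit (a F : R -> R) (T aM FM L B m s c : R)
  (k : nat -> nat) (h ms ss cs : nat -> R) :
  0 < T -> 0 < aM -> 0 < FM -> continuous_R a -> continuous_R F ->
  (forall x, 0 <= a x <= aM) -> (forall x, 0 <= F x <= FM) ->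
  uniformly_continuous_R a -> uniformly_continuous_R F ->
  (forall n, 0 <= h n) -> (forall n, T <= INR (k n) * h n) ->
  (forall n, Rabs (ms n) <= B) -> (forall n, Rabs (ss n) <= L) ->
  is_lim_seq h (Finite 0) -> is_lim_seq ms (Finite m) ->
  is_lim_seq ss (Finite s) -> is_lim_seq cs (Finite c) ->
  exists phi y, strictly_increasing phi /\ continuous_R y /\ (forall r, 0 <= y r <= aM * FM) /\
    (forall r, cc (- T) T r -> y r = a (c + r) * F (cap m s y r)) /\
    forall eps, 0 < eps -> exists N, forall n, (N <= n)%nat ->
      forall x, cc (- T) T x ->
      Rabs (tonelli (fun r => a (cs (phi n) + r)) F (h (phi n)) (ms (phi n)) (ss (phi n))
              (S (k (phi n))) x - cap m s y x) <= eps.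
Proof.
  intros HT HaM HFM Hac HFc Ha HF Hau HFu Hh Hkh HB HL Lh Lm Ls Lc.
  set (w := fun n => tonelli (fun r => a (cs n + r)) F (h n) (ms n) (ss n) (k n)).
  set (z := fun n => tonelli (fun r => a (cs n + r)) F (h n) (ms n) (ss n) (S (k n))).
  assert (HwC : forall n, continuous_R (fun r => w n (delay (h n) r))).
  { intros n. apply continuous_R_tonelli_delay; [now apply continuous_R_shift|assumption]. }
  assert (HyC : forall c w, continuous_R w -> continuous_R (fun r => a (c + r) * F (w r))).
  { intros c' w' Hw'. apply continuous_R_mult; [now apply continuous_R_shift|].
    now apply continuous_R_comp. }
  set (S := L + T * (aM * FM)).
  assert (HY : forall x v, Rabs (a x * F v) <= aM * FM).
  { intros x v. rewrite Rabs_pos_eq by (apply Rmult_le_pos; [apply Ha|apply HF]).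
    apply Rmult_le_compat; [apply Ha|apply HF|apply Ha|apply HF]. }
  assert (HL0 : 0 <= L) by (apply Rle_trans with (2 := HL O); apply Rabs_pos).
  assert (HS : 0 <= S).
  { unfold S. apply Rplus_le_le_0_compat; [assumption|].
    repeat apply Rmult_le_pos; lra. }
  assert (Hzl : forall n x y, cc (- T) T x -> cc (- T) T y ->
     Rabs (z n x - z n y) <= S * Rabs (x - y)).
  { intros n x y Hx Hy.
    apply Rle_trans with ((Rabs (ss n) + T * (aM * FM)) * Rabs (x - y)).
    - apply (cap_lipschitz (ms n) (ss n) _ T (aM * FM) y x); auto.
      exact (HyC (cs n) _ (HwC n)).
    - apply Rmult_le_compat_r; [apply Rabs_pos|]. unfold S. specialize (HL n). lra. }
  assert (HcT : forall x, cc (- T) T (clip (- T) T x)) by (intros; apply clip_cc; lra).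
  destruct (arzela (fun n x => z n (clip (- T) T x)) T S B HT HS)
    as (phi & z0 & Hphi & Hz0 & Hconv).
  - intros n x y. apply Rle_trans with (1 := Hzl n _ _ (HcT x) (HcT y)).
    apply Rmult_le_compat_l; [assumption|]. apply clip_nonexpansive.
  - intros n. rewrite clip_id by (unfold cc; lra). unfold z. simpl.
    unfold cap. rewrite iint_0.
    replace (ms n + ss n * 0 - 0) with (ms n) by ring. apply HB.
  - set (zc := fun x => z0 (clip (- T) T x)).
    assert (Hzc : continuous_R zc).
    { apply continuous_R_lipschitz with S. intros x y. unfold zc.
      apply Rle_trans with (1 := Hz0 _ _ (HcT x) (HcT y)).
      apply Rmult_le_compat_l; [assumption|]. apply clip_nonexpansive. }
    set (y := fun r => a (c + r) * F (zc r)).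
    assert (Hconv' : forall eps, 0 < eps -> exists N, forall n, (N <= n)%nat ->
      forall x, cc (- T) T x -> Rabs (z (phi n) x - z0 x) <= eps).
    { intros eps Heps. destruct (Hconv eps Heps) as (N & HN). exists N.
      intros n Hn x Hx. specialize (HN n Hn x Hx). now rewrite clip_id in HN. }
    assert (Hfix : forall tau, cc (- T) T tau -> z0 tau = cap m s y tau).
    { intros tau Htau. apply cond_eq. intros eps Heps.
      destruct (cap_source_close a F T aM FM ltac:(lra) HaM HFM Hac HFc Ha HF Hau HFu
        (eps / 2) ltac:(lra)) as (d & Hd & Hclose).
      assert (Hd' : 0 < d / (2 * (S + 1))) by (apply Rdiv_lt_0_compat; lra).
      destruct (is_lim_seq_eventually_close _ _ _ Lm Hd) as (N1 & H1).
      destruct (is_lim_seq_eventually_close _ _ _ Ls Hd) as (N2 & H2).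
      destruct (is_lim_seq_eventually_close _ _ _ Lc Hd) as (N3 & H3).
      destruct (is_lim_seq_eventually_close _ _ _ Lh Hd') as (N4 & H4).
      destruct (Hconv' (Rmin (eps / 2) (d / 2)) ltac:(apply Rmin_glb_lt; lra)) as (N5 & H5).
      remember (N1 + N2 + N3 + N4 + N5)%nat as n eqn:En.
      assert (Hn := strictly_increasing_ge_id phi Hphi n).
      assert (Hcl := Hclose (ms (phi n)) m (ss (phi n)) s (cs (phi n)) c
         (fun r => w (phi n) (delay (h (phi n)) r)) zc
         (H1 (phi n) ltac:(lia)) (H2 (phi n) ltac:(lia)) (H3 (phi n) ltac:(lia)) (HwC _) Hzc).
      assert (H5' : forall x, cc (- T) T x ->
         Rabs (z (phi n) x - z0 x) <= eps / 2 /\ Rabs (z (phi n) x - z0 x) <= d / 2).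
      { intros x Hx. specialize (H5 n ltac:(lia) x Hx). split.
        - apply Rle_trans with (1 := H5). apply Rmin_l.
        - apply Rle_trans with (1 := H5). apply Rmin_r. }
      assert (Hdel : forall r, Rabs r <= T ->
         Rabs (w (phi n) (delay (h (phi n)) r) - zc r) < d).
      { intros r Hr.
        assert (Hdr : Rabs (delay (h (phi n)) r) <= T).
        { apply Rle_trans with (2 := Hr). now apply delay_shrinks. }
        (* Stationarity replaces iterate k by iterate k + 1, the one known to converge; the delay
           then costs at most S h. *)
        assert (E : w (phi n) (delay (h (phi n)) r) = z (phi n) (delay (h (phi n)) r)).
        { symmetry. apply tonelli_stationary; [apply Hh|].
          apply Rle_trans with (1 := Hdr). apply Hkh. }
        rewrite E. unfold zc. apply Rabs_le_cc in Hr, Hdr. rewrite clip_id by assumption.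
        assert (Ha1 := Hzl (phi n) _ _ Hdr Hr).
        destruct (H5' r Hr) as [_ Ha2].
        assert (Ha3 := delay_near (h (phi n)) r (Hh _)).
        assert (Ha4 := H4 (phi n) ltac:(lia)). rewrite Rminus_0_r, Rabs_pos_eq in Ha4 by apply Hh.
        assert (Ha5 : S * Rabs (delay (h (phi n)) r - r) <= S * (d / (2 * (S + 1))))
          by (apply Rmult_le_compat_l; lra).
        assert (Ha6 : S * (d / (2 * (S + 1))) < d / 2).
        { replace (d / 2) with ((S + 1) * (d / (2 * (S + 1)))) by (field; lra).
          rewrite Rmult_plus_distr_r. lra. }
        replace (z (phi n) (delay (h (phi n)) r) - z0 r) with
          ((z (phi n) (delay (h (phi n)) r) - z (phi n) r) + (z (phi n) r - z0 r)) by ring.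
        apply Rle_lt_trans with (1 := Rabs_triang _ _). lra. }
      specialize (Hcl Hdel tau (proj2 (Rabs_le_cc T tau) Htau)).
      change (Rabs (z (phi n) tau - cap m s y tau) < eps / 2) in Hcl.
      destruct (H5' tau Htau) as [H6 _].
      apply Rabs_lt_between in Hcl. apply Rabs_le_between in H6. apply Rabs_lt_between. lra. }
    exists phi, y. split; [assumption|]. split; [now apply HyC|].
    split.
    { intros r. split; [apply Rmult_le_pos; [apply Ha|apply HF]|].
      apply Rle_trans with (2 := HY (c + r) (zc r)). apply Rle_abs. }
    split.
    + intros r Hr. rewrite <- Hfix by assumption. unfold y, zc. now rewrite clip_id.
    + intros eps Heps. destruct (Hconv' eps Heps) as (N & HN). exists N.
      intros n Hn x Hx. rewrite <- Hfix by assumption. now apply HN.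
Qed.

(** * Shooting from the maximum *)

Definition left_defect (eta beta : R) (u : R -> R) : R := u 0 - beta * u eta.

Definition right_defect (T eta alpha : R) (u : R -> R) : R :=
  u T - alpha * RInt u 0 eta.

Lemma left_defect_close (T eta beta e : R) (u v : R -> R) :
  0 < eta < T -> 0 <= beta -> (forall t, cc 0 T t -> Rabs (u t - v t) <= e) ->
  Rabs (left_defect eta beta u - left_defect eta beta v) <= (1 + beta) * e.
Proof.
  intros Heta Hb H. unfold left_defect.
  assert (H1 := H 0 ltac:(unfold cc; lra)). assert (H2 := H eta ltac:(unfold cc; lra)).
  replace (u 0 - beta * u eta - (v 0 - beta * v eta)) with
    ((u 0 - v 0) - beta * (u eta - v eta)) by ring.
  apply Rle_trans with (1 := Rabs_triang _ _).
  rewrite Rabs_Ropp, Rabs_mult, (Rabs_pos_eq beta) by assumption.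
  assert (beta * Rabs (u eta - v eta) <= beta * e) by (now apply Rmult_le_compat_l). lra.
Qed.

Lemma right_defect_close (T eta alpha e : R) (u v : R -> R) :
  0 < eta < T -> 0 < alpha -> continuous_R u -> continuous_R v ->
  (forall t, cc 0 T t -> Rabs (u t - v t) <= e) ->
  Rabs (right_defect T eta alpha u - right_defect T eta alpha v) <= (1 + alpha * eta) * e.
Proof.
  intros Heta Ha Hu Hv H. unfold right_defect.
  assert (H1 := H T ltac:(unfold cc; lra)).
  replace (u T - alpha * RInt u 0 eta - (v T - alpha * RInt v 0 eta)) with
    ((u T - v T) - alpha * (RInt u 0 eta - RInt v 0 eta)) by ring.
  rewrite <- RInt_minus_R by assumption.
  apply Rle_trans with (1 := Rabs_triang _ _).
  rewrite Rabs_Ropp, Rabs_mult, (Rabs_pos_eq alpha) by lra.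
  assert (Hi : Rabs (RInt (fun t => u t - v t) 0 eta) <= Rabs (eta - 0) * e).
  { apply Rabs_RInt_le_const; [now apply continuous_R_minus|].
    intros r. rewrite (Rmin_left 0 eta), (Rmax_right 0 eta) by lra. intros Hr. apply H. unfold cc; lra. }
  rewrite Rminus_0_r, (Rabs_pos_eq eta) in Hi by lra.
  assert (alpha * Rabs (RInt (fun t => u t - v t) 0 eta) <= alpha * (eta * e))
    by (apply Rmult_le_compat_l; lra).
  lra.
Qed.

(* A shot is determined by its maximum [m] and by [theta]: the maximum is attained
   at [theta] if [theta] is in [0,T]; beyond the end points of [0,T], the excess of
   [theta] is the slope at that end point. *)
Definition shot (a F : R -> R) (T h m theta : R) (k : nat) (t : R) : R :=
  tonelli (fun r => a (clip 0 T theta + r)) F h m (theta - clip 0 T theta) k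
    (t - clip 0 T theta).

(** The launching slope is negative only at 0, positive only at T and zero in between, so the linear
    part of a shot never rises above its launching value; concavity does the rest. *)
Lemma excess_sign (T theta t : R) : 0 < T -> cc 0 T t ->
  (theta - clip 0 T theta) * (t - clip 0 T theta) <= 0.
Proof.
  unfold cc. intros HT Ht. unfold clip, Rmax, Rmin. repeat destruct Rle_dec; nra.
Qed.

Lemma excess_bound (T L theta : R) : 0 < T -> 0 <= L -> cc (- L) (T + L) theta ->
  Rabs (theta - clip 0 T theta) <= L.
Proof.
  unfold cc, clip, Rmax, Rmin. intros. apply Rabs_le. repeat destruct Rle_dec; lra.
Qed.

Lemma continuous_R_translate (g : R -> R) (c : R) :
  continuous_R g -> continuous_R (fun t => g (t - c)).
Proof.
  intros Hg. apply continuous_R_comp; [assumption|].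
  apply continuous_R_minus; [apply continuous_R_id|apply continuous_R_const].
Qed.

Lemma continuous_R_shot (a F : R -> R) (T h m theta : R) (k : nat) :
  continuous_R a -> continuous_R F -> continuous_R (shot a F T h m theta k).
Proof.
  intros Ha HF. apply continuous_R_translate. apply continuous_R_tonelli; [|assumption].
  now apply continuous_R_shift.
Qed.

Lemma cc_translate_clip (T theta t : R) :
  0 < T -> cc 0 T t -> cc (- T) T (t - clip 0 T theta).
Proof.
  intros HT Ht. assert (H := clip_cc 0 T theta ltac:(lra)). unfold cc in *. lra.
Qed.

Lemma shot_uniformly_continuous (a F : R -> R) (T L h aM FM : R) (k : nat) :
  0 < T -> 0 <= L -> 0 <= h -> 0 < aM -> 0 < FM -> continuous_R a -> continuous_R F ->
  (forall x, 0 <= a x <= aM) -> (forall x, 0 <= F x <= FM) ->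
  uniformly_continuous_R a -> uniformly_continuous_R F ->
  forall eps, 0 < eps -> exists del, 0 < del /\
  forall m m' theta theta', cc (- L) (T + L) theta -> cc (- L) (T + L) theta' ->
  Rabs (m - m') < del -> Rabs (theta - theta') < del ->
  forall t, cc 0 T t ->
  Rabs (shot a F T h m theta (S k) t - shot a F T h m' theta' (S k) t) <= eps.
Proof.
  intros HT HL Hh HaM HFM Hac HFc Ha HF Hau HFu eps Heps.
  destruct (tonelli_uniformly_continuous a F T h aM FM (S k) ltac:(lra) Hh HaM HFM
    Hac HFc Ha HF Hau HFu (eps / 2) ltac:(lra)) as (d & Hd & Hz).
  set (K := L + T * (aM * FM)).
  assert (HMM : 0 < aM * FM) by now apply Rmult_lt_0_compat.
  assert (HK : 0 <= K) by (unfold K; assert (0 <= T * (aM * FM)) by (apply Rmult_le_pos; lra); lra).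
  set (d2 := eps / (2 * (K + 1))).
  assert (Hd2 : 0 < d2) by (apply Rdiv_lt_0_compat; lra).
  assert (HKd : K * d2 <= eps / 2).
  { replace (eps / 2) with ((K + 1) * d2) by (unfold d2; field; lra). nra. }
  (* By the triangle inequality the slope changes by at most twice the change of [theta], hence d /
     2; d2 controls the move of the launching point. *)
  exists (Rmin (d / 2) d2). split; [apply Rmin_glb_lt; lra|].
  intros m m' theta theta' Hth Hth' Hm Ht t Htt.
  assert (Hmin : forall x, x < Rmin (d / 2) d2 -> x < d / 2 /\ x < d2).
  { intros x. unfold Rmin. destruct Rle_dec; lra. }
  destruct (Hmin _ Hm) as [Hm1 _]. destruct (Hmin _ Ht) as [Ht1 Ht2].
  assert (Hcc := clip_nonexpansive 0 T theta theta').
  assert (R1 := cc_translate_clip T theta t HT Htt).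
  assert (R2 := cc_translate_clip T theta' t HT Htt).
  assert (Hs := excess_bound T L theta' HT HL Hth').
  unfold shot.
  set (c := clip 0 T theta) in *. set (c' := clip 0 T theta') in *.
  set (z := tonelli (fun r => a (c + r)) F h m (theta - c) (S k)).
  set (z' := tonelli (fun r => a (c' + r)) F h m' (theta' - c') (S k)).
  assert (H1 : Rabs (z (t - c) - z' (t - c)) < eps / 2).
  { apply Hz; try lra.
    - replace (theta - c - (theta' - c')) with ((theta - theta') - (c - c')) by ring.
      apply Rle_lt_trans with (1 := Rabs_triang _ _). rewrite Rabs_Ropp. lra.
    - now apply Rabs_le_cc. }
  assert (H2 : Rabs (z' (t - c) - z' (t - c')) <= K * d2).
  { apply Rle_trans with ((Rabs (theta' - c') + T * (aM * FM)) * Rabs (t - c - (t - c'))).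
    - apply (cap_lipschitz m' (theta' - c') _ T (aM * FM) (t - c') (t - c)); try assumption.
      + apply continuous_R_tonelli; [now apply continuous_R_shift|assumption].
      + intros r. rewrite Rabs_pos_eq by (apply Rmult_le_pos; [apply Ha|apply HF]).
        apply Rmult_le_compat; try apply Ha; apply HF.
    - apply Rmult_le_compat; try apply Rabs_pos.
      + apply Rplus_le_le_0_compat; [apply Rabs_pos|apply Rmult_le_pos; lra].
      + unfold K. lra.
      + replace (t - c - (t - c')) with (- (c - c')) by ring. rewrite Rabs_Ropp. lra. }
  apply Rabs_lt_between in H1. apply Rabs_le_between in H2. apply Rabs_le. lra.
Qed.

(** The slope -L contributes -L (T - alpha eta^2 / 2), a negative multiple of L by the bound on
    alpha. The source contributes alpha J - B <= 0, so the estimate is uniform in y. *)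
Lemma right_defect_steep_down (T eta alpha m L hi : R) (y : R -> R) :
  continuous_R y -> (forall r, 0 <= y r) ->
  0 < eta < T -> 0 < alpha -> 0 < 2 * T - alpha * eta ^ 2 -> 0 < m <= hi ->
  (hi + 1) / (T - alpha * eta ^ 2 / 2) <= L ->
  right_defect T eta alpha (cap m (- L) y) <= -1.
Proof.
  intros Hy H0 Heta Ha Ha2 Hm HL. unfold right_defect. rewrite RInt_cap by assumption.
  unfold cap.
  assert (HB := iint_nonneg y T Hy H0).
  assert (HJ := RInt_iint_star y T eta Hy H0 ltac:(lra)).
  assert (HL' : hi + 1 <= L * (T - alpha * eta ^ 2 / 2)).
  { apply Rle_div_l; [lra|assumption]. }
  assert (Hj : alpha * RInt (iint y) 0 eta <= iint y T).
  { apply Rmult_le_reg_l with T; [lra|].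
    apply Rle_trans with (alpha * (eta * eta / 2 * iint y T)).
    - rewrite <- Rmult_assoc, (Rmult_comm T), Rmult_assoc. apply Rmult_le_compat_l; lra.
    - assert (0 <= (2 * T - alpha * eta ^ 2) * iint y T) by (apply Rmult_le_pos; lra). nra. }
  assert (0 < alpha * eta * m) by (repeat apply Rmult_lt_0_compat; lra).
  nra.
Qed.

(** Here u(T) = m is fixed and the source only lowers the integral, so comparison with the tangent
    line at T is enough. *)
Lemma right_defect_steep_up (T eta alpha m L hi : R) (y : R -> R) :
  continuous_R y -> (forall r, 0 <= y r) ->
  0 < eta < T -> 0 < alpha -> 0 < m <= hi ->
  (hi + 1 / (alpha * eta)) / (T - eta / 2) <= L ->
  1 <= right_defect T eta alpha (fun t => cap m L y (t - T)).
Proof.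
  intros Hy H0 Heta Ha Hm HL. unfold right_defect.
  assert (Hi : RInt (fun t => cap m L y (t - T)) 0 eta
               <= (m - L * T) * eta + L * (eta * eta / 2)).
  { rewrite <- RInt_affine. apply RInt_le_R; try lra.
    - now apply continuous_R_translate, continuous_R_cap.
    - apply continuous_R_plus; [apply continuous_R_const|].
      apply continuous_R_mult; [apply continuous_R_const|apply continuous_R_id].
    - intros t Ht. unfold cap. assert (H := iint_nonneg y (t - T) Hy H0). lra. }
  unfold cap at 1. rewrite Rminus_diag, iint_0.
  assert (Hae : 0 < alpha * eta) by now apply Rmult_lt_0_compat.
  assert (HL' : hi + 1 / (alpha * eta) <= L * (T - eta / 2)).
  { apply Rle_div_l; [lra|assumption]. }
  assert (H1 : alpha * eta * (hi + 1 / (alpha * eta)) <= alpha * eta * (L * (T - eta / 2)))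
    by (apply Rmult_le_compat_l; lra).
  replace (alpha * eta * (hi + 1 / (alpha * eta))) with (alpha * eta * hi + 1) in H1
    by (field; lra).
  assert (alpha * RInt (fun t => cap m L y (t - T)) 0 eta
          <= alpha * ((m - L * T) * eta + L * (eta * eta / 2)))
    by (apply Rmult_le_compat_l; lra).
  assert (alpha * eta * m <= alpha * eta * hi) by (apply Rmult_le_compat_l; lra).
  nra.
Qed.

Lemma is_lim_seq_continuous_R (g : R -> R) (u : nat -> R) (l : R) :
  continuous_R g -> is_lim_seq u (Finite l) -> is_lim_seq (fun n => g (u n)) (Finite (g l)).
Proof.
  intros Hg Hu. apply is_lim_seq_continuous; [|assumption].
  apply continuity_pt_filterlim. apply Hg.
Qed.

Lemma is_lim_seq_harmonic (T : R) : is_lim_seq (fun n => T / (INR n + 1)) (Finite 0).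
Proof.
  replace (Finite 0) with (Rbar_mult (Finite T) (Finite 0)) by (simpl; f_equal; ring).
  apply (is_lim_seq_scal_l (fun n => / (INR n + 1))).
  replace (Finite 0) with (Rbar_inv p_infty) by reflexivity.
  apply is_lim_seq_inv; [|discriminate].
  apply is_lim_seq_ext with (fun n => INR (S n)); [intros; apply S_INR|].
  apply (is_lim_seq_incr_1 INR). apply is_lim_seq_INR.
Qed.

Lemma approximate_shots (T eta alpha beta rho1 rho2 aM FM : R) (a F : R -> R) :
  0 < eta < T -> 0 < alpha -> 0 <= beta -> 0 < 2 * T - alpha * eta ^ 2 ->
  0 < aM -> 0 < FM -> continuous_R a -> continuous_R F ->
  (forall x, 0 <= a x <= aM) -> (forall x, 0 <= F x <= FM) ->
  uniformly_continuous_R a -> uniformly_continuous_R F ->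
  0 < rho1 -> 0 < rho2 ->
  exists L, 0 <= L /\ forall h k eps, 0 <= h -> 0 < eps < 1 ->
  exists x y, cc 0 1 x /\ cc 0 1 y /\
    let u := shot a F T h (rho1 + (rho2 - rho1) * x) (- L + (T + 2 * L) * y) (S k) in
    Rabs (right_defect T eta alpha u) <= eps /\
    (Rabs (left_defect eta beta u) <= eps
     \/ (x = 0 /\ left_defect eta beta u <= 0)
     \/ (x = 1 /\ 0 <= left_defect eta beta u)).
Proof.
  intros Heta Hal Hb Ha2 HaM HFM Hac HFc Ha HF Hau HFu Hr1 Hr2.
  set (hi := rho1 + rho2).
  assert (Hae : 0 < alpha * eta) by (apply Rmult_lt_0_compat; lra).
  set (L1 := (hi + 1) / (T - alpha * eta ^ 2 / 2)).
  set (L2 := (hi + 1 / (alpha * eta)) / (T - eta / 2)).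
  assert (HL1 : 0 < L1) by (apply Rdiv_lt_0_compat; unfold hi; lra).
  assert (HL2 : 0 < L2).
  { apply Rdiv_lt_0_compat; [|lra]. unfold hi.
    assert (0 < 1 / (alpha * eta)) by (apply Rdiv_lt_0_compat; lra). lra. }
  (* L exceeds both thresholds and is fixed before the delay, so [theta] stays in one compact
     interval as the delay tends to 0. *)
  exists (L1 + L2). split; [lra|].
  assert (HL : 0 < L1 + L2 /\ L1 <= L1 + L2 /\ L2 <= L1 + L2) by lra.
  generalize dependent (L1 + L2). intros L (HL & HLL1 & HLL2) h k eps Hh Heps.
  assert (Hm : forall x, cc 0 1 x -> 0 < rho1 + (rho2 - rho1) * x <= hi).
  { unfold cc, hi. intros x Hx. split; nra. }
  assert (Hth : forall y, cc 0 1 y -> cc (- L) (T + L) (- L + (T + 2 * L) * y)).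
  { unfold cc. intros y Hy. split; nra. }
  set (U := fun x y => shot a F T h (rho1 + (rho2 - rho1) * x) (- L + (T + 2 * L) * y) (S k)).
  destruct (approximate_poincare_miranda (fun x y => left_defect eta beta (U x y))
    (fun x y => right_defect T eta alpha (U x y)) eps) as (x & y & Hx & Hy & H).
  - lra.
  - set (w := eps / (2 * (1 + beta + alpha * eta))).
    assert (Hw : 0 < w) by (apply Rdiv_lt_0_compat; lra).
    assert (Hw' : (1 + beta) * w < eps /\ (1 + alpha * eta) * w < eps).
    { assert (E : (1 + beta) * w + (1 + alpha * eta) * w = eps / 2 + w).
      { unfold w. field. lra. }
      assert (0 <= beta * w) by (apply Rmult_le_pos; lra).
      assert (0 <= alpha * eta * w) by (apply Rmult_le_pos; lra).
      lra. }
    destruct (shot_uniformly_continuous a F T L h aM FM k ltac:(lra) ltac:(lra) Hh HaM HFM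
      Hac HFc Ha HF Hau HFu w Hw) as (d & Hd & Hcl).
    set (K := rho1 + rho2 + T + 2 * L).
    assert (HK : 0 < K) by (unfold K; lra).
    exists (d / K). split; [now apply Rdiv_lt_0_compat|].
    intros x y x' y' Hx Hy Hx' Hy' Hdx Hdy.
    assert (Hscale : forall b v, Rabs b <= K -> Rabs v < d / K -> Rabs (b * v) < d).
    { intros b v Hbk Hv. rewrite Rabs_mult.
      apply Rle_lt_trans with (K * Rabs v).
      - apply Rmult_le_compat_r; [apply Rabs_pos|assumption].
      - replace d with (K * (d / K)) by (field; lra). now apply Rmult_lt_compat_l. }
    assert (HU : forall t, cc 0 T t -> Rabs (U x' y' t - U x y t) <= w).
    { apply Hcl; try now apply Hth.
      - replace (rho1 + (rho2 - rho1) * x' - (rho1 + (rho2 - rho1) * x))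
          with ((rho2 - rho1) * (x' - x)) by ring.
        apply Hscale; [|assumption]. unfold K. apply Rabs_le. lra.
      - replace (- L + (T + 2 * L) * y' - (- L + (T + 2 * L) * y))
          with ((T + 2 * L) * (y' - y)) by ring.
        apply Hscale; [|assumption]. unfold K. apply Rabs_le. lra. }
    split.
    + apply Rle_lt_trans with (2 := proj1 Hw'). now apply left_defect_close with T.
    + apply Rle_lt_trans with (2 := proj2 Hw').
      apply right_defect_close; try assumption; now apply continuous_R_shot.
  - intros x Hx. apply Rle_lt_trans with (-1); [|lra].
    unfold U, shot. rewrite Rmult_0_r, Rplus_0_r.
    replace (clip 0 T (- L)) with 0
      by (unfold clip, Rmax, Rmin; repeat destruct Rle_dec; lra).
    rewrite Rminus_0_r.
    set (y := fun r => a (0 + r) * F (tonelli (fun r => a (0 + r)) F h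
                 (rho1 + (rho2 - rho1) * x) (- L) k (delay h r))).
    assert (Hd := right_defect_steep_down T eta alpha (rho1 + (rho2 - rho1) * x) L hi y).
    assert (E : (fun t => cap (rho1 + (rho2 - rho1) * x) (- L) y (t - 0))
                = cap (rho1 + (rho2 - rho1) * x) (- L) y).
    { apply functional_extensionality. intros t. now rewrite Rminus_0_r. }
    simpl. fold y. rewrite E. apply Hd; auto.
    + apply (continuous_R_tonelli (fun r => a (0 + r))); [now apply continuous_R_shift|assumption].
    + intros r. apply Rmult_le_pos; [apply Ha|apply HF].
  - intros x Hx. apply Rlt_le_trans with 1; [lra|].
    unfold U, shot. rewrite Rmult_1_r.
    replace (- L + (T + 2 * L)) with (T + L) by ring.
    replace (clip 0 T (T + L)) with T
      by (unfold clip, Rmax, Rmin; repeat destruct Rle_dec; lra).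
    replace (T + L - T) with L by ring.
    simpl. apply right_defect_steep_up with hi; auto.
    + apply (continuous_R_tonelli (fun r => a (T + r))); [now apply continuous_R_shift|assumption].
    + intros r. apply Rmult_le_pos; [apply Ha|apply HF].
  - exists x, y. split; [assumption|]. split; assumption.
Qed.

Lemma exact_shot (T eta alpha beta rho1 rho2 aM FM : R) (a F : R -> R) :
  0 < eta < T -> 0 < alpha -> 0 <= beta -> 0 < 2 * T - alpha * eta ^ 2 ->
  0 < aM -> 0 < FM -> continuous_R a -> continuous_R F ->
  (forall x, 0 <= a x <= aM) -> (forall x, 0 <= F x <= FM) ->
  uniformly_continuous_R a -> uniformly_continuous_R F ->
  0 < rho1 -> 0 < rho2 ->
  exists p q y tau, continuous_R y /\ (forall r, 0 <= y r) /\
    (forall t, cc 0 T t -> y t = a t * F (cap p q y t)) /\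
    cc 0 T tau /\ (forall t, cc 0 T t -> cap p q y t <= cap p q y tau) /\
    right_defect T eta alpha (cap p q y) = 0 /\
    (left_defect eta beta (cap p q y) = 0
       /\ Rmin rho1 rho2 <= cap p q y tau <= Rmax rho1 rho2
     \/ left_defect eta beta (cap p q y) <= 0 /\ cap p q y tau = rho1
     \/ 0 <= left_defect eta beta (cap p q y) /\ cap p q y tau = rho2).
Proof.
  intros Heta Hal Hb Ha2 HaM HFM Hac HFc Ha HF Hau HFu Hr1 Hr2.
  destruct (approximate_shots T eta alpha beta rho1 rho2 aM FM a F) as (L & HL & Happ);
    try assumption.
  set (hs := fun n => T / (INR n + 1)).
  assert (Hhs : forall n, 0 < hs n).
  { intros n. apply Rdiv_lt_0_compat; [lra|]. generalize (pos_INR n); lra. }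
  set (es := fun n : nat => / (INR n + 2)).
  assert (Hes : forall n, 0 < es n < 1).
  { intros n. assert (Hn := pos_INR n). unfold es. split.
    - apply Rinv_0_lt_compat. lra.
    - rewrite <- Rinv_1. apply Rinv_lt_contravar; lra. }
  (* n + 1 steps of length T / (n + 1) cover [-T,T], so iterate n + 1 is already stationary there
     and iterate n + 2 solves the delayed equation. *)
  set (sh := fun n x y =>
    shot a F T (hs n) (rho1 + (rho2 - rho1) * x) (- L + (T + 2 * L) * y) (S (S n))).
  assert (Hex : forall n, exists xy, cc 0 1 (fst xy) /\ cc 0 1 (snd xy) /\
    let u := sh n (fst xy) (snd xy) in
    Rabs (right_defect T eta alpha u) <= es n /\
    (Rabs (left_defect eta beta u) <= es n
     \/ (fst xy = 0 /\ left_defect eta beta u <= 0)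
     \/ (fst xy = 1 /\ 0 <= left_defect eta beta u))).
  { intros n. destruct (Happ (hs n) (S n) (es n)) as (x & y & H).
    - left. apply Hhs.
    - apply Hes.
    - now exists (x, y). }
  set (xs := fun n => fst (proj1_sig (constructive_indefinite_description _ (Hex n)))).
  set (ys := fun n => snd (proj1_sig (constructive_indefinite_description _ (Hex n)))).
  assert (Hxy : forall n, cc 0 1 (xs n) /\ cc 0 1 (ys n) /\
    Rabs (right_defect T eta alpha (sh n (xs n) (ys n))) <= es n /\
    (Rabs (left_defect eta beta (sh n (xs n) (ys n))) <= es n
     \/ (xs n = 0 /\ left_defect eta beta (sh n (xs n) (ys n)) <= 0)
     \/ (xs n = 1 /\ 0 <= left_defect eta beta (sh n (xs n) (ys n))))).
  { intros n. exact (proj2_sig (constructive_indefinite_description _ (Hex n))). }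
  clearbody xs ys. clear Hex Happ.
  assert (H01 : forall x, cc 0 1 x -> Rabs x <= 1).
  { unfold cc. intros x Hx. apply Rabs_le. lra. }
  destruct (bounded_subsequence xs 1) as (f1 & x & Hf1 & Lx); [intros; apply H01, Hxy|].
  destruct (bounded_subsequence (fun n => ys (f1 n)) 1) as (f2 & y & Hf2 & Ly);
    [intros; apply H01, Hxy|].
  assert (Hf := strictly_increasing_comp f1 f2 Hf1 Hf2).
  apply (is_lim_seq_subseq _ _ f2) in Lx; [|now apply eventually_subseq].
  assert (Lh := is_lim_seq_subseq _ _ _ (eventually_subseq _ Hf) (is_lim_seq_harmonic T)).
  set (f := fun n => f1 (f2 n)) in *.
  set (m := fun x => rho1 + (rho2 - rho1) * x).
  set (c := fun y => clip 0 T (- L + (T + 2 * L) * y)).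
  set (s := fun y => - L + (T + 2 * L) * y - c y).
  assert (Haff : forall p q, continuous_R (fun x => p + q * x)).
  { intros p q. apply continuous_R_plus; [apply continuous_R_const|].
    apply continuous_R_mult; [apply continuous_R_const|apply continuous_R_id]. }
  assert (Hc : continuous_R c).
  { apply (continuous_R_comp (clip 0 T)); [apply continuous_R_clip|apply Haff]. }
  assert (Hs : continuous_R s) by (apply continuous_R_minus; [apply Haff|assumption]).
  assert (Hth : forall y, cc 0 1 y -> cc (- L) (T + L) (- L + (T + 2 * L) * y)).
  { unfold cc. intros w Hw. split; nra. }
  destruct (tonelli_limit a F T aM FM L (rho1 + rho2) (m x) (s y) (c y)
     (fun n => S (f n)) (fun n => hs (f n)) (fun n => m (xs (f n)))
     (fun n => s (ys (f n))) (fun n => c (ys (f n))))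
    as (phi & Y & Hphi & HYc & HY0 & HYeq & Hconv); try assumption; try lra.
  - intros n. left. apply Hhs.
  - intros n. unfold hs. rewrite S_INR. right. field. generalize (pos_INR (f n)); lra.
  - intros n. destruct (Hxy (f n)) as ([H1 H2] & _). unfold m. apply Rabs_le. split; nra.
  - intros n. apply excess_bound; [lra|assumption|]. apply Hth, Hxy.
  - apply (is_lim_seq_continuous_R m (fun n => xs (f n))); [apply Haff|assumption].
  - now apply (is_lim_seq_continuous_R s (fun n => ys (f n))).
  - now apply (is_lim_seq_continuous_R c (fun n => ys (f n))).
  - assert (HT : 0 < T) by lra.
    assert (Hx01 : cc 0 1 x).
    { split.
      - apply (is_lim_seq_le (fun _ => 0) (fun n => xs (f n)) (Finite 0) (Finite x));
          [intros; apply Hxy|apply is_lim_seq_const|assumption].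
      - apply (is_lim_seq_le (fun n => xs (f n)) (fun _ => 1) (Finite x) (Finite 1));
          [intros; apply Hxy|assumption|apply is_lim_seq_const]. }
    destruct (cap_shift (m x) (s y) (c y) Y HYc) as (p & q & Hpq).
    assert (Hpq' : (fun t => cap (m x) (s y) Y (t - c y)) = cap p q (fun r => Y (r - c y))).
    { apply functional_extensionality. exact Hpq. }
    set (u := cap p q (fun r => Y (r - c y))) in *.
    assert (Hyc' : continuous_R (fun r => Y (r - c y))) by now apply continuous_R_translate.
    assert (Huc : continuous_R u) by now apply continuous_R_cap.
    (* The launching points converge as well; the Lipschitz bound of the limit shot compares the two
       relative times of the same t. *)
    assert (Huconv : forall eps, 0 < eps -> exists N, forall n, (N <= n)%nat ->
      forall t, cc 0 T t ->
      Rabs (sh (f (phi n)) (xs (f (phi n))) (ys (f (phi n))) t - u t) <= eps).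
    { intros eps Heps.
      destruct (Hconv (eps / 2) ltac:(lra)) as (N1 & H1).
      set (K := Rabs (s y) + T * (aM * FM)).
      assert (HK : 0 <= K).
      { unfold K. apply Rplus_le_le_0_compat; [apply Rabs_pos|].
        repeat apply Rmult_le_pos; lra. }
      assert (Hd : 0 < eps / (2 * (K + 1))) by (apply Rdiv_lt_0_compat; lra).
      assert (HKd : K * (eps / (2 * (K + 1))) <= eps / 2).
      { replace (eps / 2) with ((K + 1) * (eps / (2 * (K + 1)))) by (field; lra).
        rewrite Rmult_plus_distr_r. lra. }
      assert (Lc := is_lim_seq_continuous_R c _ _ Hc Ly).
      destruct (is_lim_seq_eventually_close _ _ _ Lc Hd) as (N2 & H2).
      exists (max N1 N2). intros n Hn t Ht.
      assert (Hn' := strictly_increasing_ge_id phi Hphi n).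
      specialize (H2 (phi n) ltac:(lia)).
      change (Rabs (c (ys (f (phi n))) - c y) < eps / (2 * (K + 1))) in H2.
      assert (R1 := cc_translate_clip T (- L + (T + 2 * L) * ys (f (phi n))) t HT Ht).
      assert (R2 := cc_translate_clip T (- L + (T + 2 * L) * y) t HT Ht).
      specialize (H1 n ltac:(lia) _ R1).
      change (clip 0 T (- L + (T + 2 * L) * ys (f (phi n)))) with (c (ys (f (phi n)))) in *.
      change (clip 0 T (- L + (T + 2 * L) * y)) with (c y) in *.
      assert (H3 : Rabs (cap (m x) (s y) Y (t - c (ys (f (phi n)))) - cap (m x) (s y) Y (t - c y))
                   <= K * Rabs (t - c (ys (f (phi n))) - (t - c y))).
      { apply cap_lipschitz; try assumption. intros r. rewrite Rabs_pos_eq; apply HY0. }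
      replace (t - c (ys (f (phi n))) - (t - c y)) with (- (c (ys (f (phi n))) - c y)) in H3 by ring.
      rewrite Rabs_Ropp in H3.
      assert (H4 : K * Rabs (c (ys (f (phi n))) - c y) <= K * (eps / (2 * (K + 1))))
        by (apply Rmult_le_compat_l; lra).
      rewrite <- (Hpq t).
      replace (sh (f (phi n)) (xs (f (phi n))) (ys (f (phi n))) t - cap (m x) (s y) Y (t - c y))
        with ((sh (f (phi n)) (xs (f (phi n))) (ys (f (phi n))) t
               - cap (m x) (s y) Y (t - c (ys (f (phi n)))))
              + (cap (m x) (s y) Y (t - c (ys (f (phi n)))) - cap (m x) (s y) Y (t - c y))) by ring.
      apply Rle_trans with (1 := Rabs_triang _ _).
      replace eps with (eps / 2 + eps / 2) by field.
      apply Rplus_le_compat; [exact H1|lra]. }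
    assert (Les : is_lim_seq es (Finite 0)).
    { apply is_lim_seq_ext with (fun n => 1 / (INR (S n) + 1)).
      - intros n. rewrite S_INR. unfold es. field. generalize (pos_INR n); lra.
      - apply (is_lim_seq_incr_1 (fun n => 1 / (INR n + 1))). apply is_lim_seq_harmonic. }
    assert (Hdef : forall eps, 0 < eps -> exists n,
      es (f (phi n)) <= eps /\ Rabs (xs (f (phi n)) - x) < eps /\
      Rabs (left_defect eta beta (sh (f (phi n)) (xs (f (phi n))) (ys (f (phi n))))
            - left_defect eta beta u) <= eps /\
      Rabs (right_defect T eta alpha (sh (f (phi n)) (xs (f (phi n))) (ys (f (phi n))))
            - right_defect T eta alpha u) <= eps).
    { intros eps Heps.
      assert (Hae : 0 < alpha * eta) by (apply Rmult_lt_0_compat; lra).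
      set (w := eps / (1 + beta + alpha * eta)).
      assert (Hw : 0 < w) by (apply Rdiv_lt_0_compat; lra).
      assert (Hw' : (1 + beta) * w <= eps /\ (1 + alpha * eta) * w <= eps).
      { assert (E : w + beta * w + alpha * eta * w = eps) by (unfold w; field; lra).
        assert (0 <= beta * w) by (apply Rmult_le_pos; lra).
        assert (0 <= alpha * eta * w) by (apply Rmult_le_pos; lra). lra. }
      destruct (Huconv w Hw) as (N1 & H1).
      destruct (is_lim_seq_eventually_close _ _ _ Lx Heps) as (N2 & H2).
      destruct (is_lim_seq_eventually_close _ _ _ Les Heps) as (N3 & H3).
      remember (N1 + N2 + N3)%nat as n eqn:En. exists n.
      assert (Hn := strictly_increasing_ge_id phi Hphi n).
      assert (Hfn := strictly_increasing_ge_id f Hf (phi n)).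
      specialize (H1 n ltac:(lia)). specialize (H2 (phi n) ltac:(lia)).
      specialize (H3 (f (phi n)) ltac:(lia)).
      apply Rabs_lt_between in H3.
      split; [lra|]. split; [exact H2|]. split.
      - apply Rle_trans with (2 := proj1 Hw'). now apply left_defect_close with T.
      - apply Rle_trans with (2 := proj2 Hw'). apply right_defect_close; try assumption.
        now apply continuous_R_shot. }
    assert (Hcy : cc 0 T (c y)) by (apply clip_cc; lra).
    assert (Htop : u (c y) = m x).
    { rewrite <- (Hpq (c y)), Rminus_diag. unfold cap. rewrite iint_0. ring. }
    exists p, q, (fun r => Y (r - c y)), (c y). fold u.
    split; [assumption|]. split; [intros; apply HY0|]. split; [|split; [assumption|split; [|split]]].
    + intros t Ht. rewrite <- (Hpq t).
      rewrite HYeq by (apply cc_translate_clip; assumption). do 2 f_equal. ring.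
    + intros t Ht. rewrite Htop, <- (Hpq t). unfold cap.
      assert (H1 := iint_nonneg Y (t - c y) HYc (fun r => proj1 (HY0 r))).
      assert (H2 := excess_sign T (- L + (T + 2 * L) * y) t HT Ht).
      change (s y * (t - c y) <= 0) in H2. lra.
    + apply cond_eq. intros eps Heps. rewrite Rminus_0_r.
      destruct (Hdef (eps / 3) ltac:(lra)) as (n & He & _ & _ & H2).
      destruct (Hxy (f (phi n))) as (_ & _ & H3 & _).
      apply Rabs_le_between in H2. apply Rabs_le_between in H3. apply Rabs_lt_between. lra.
    + rewrite Htop.
      destruct (Rtotal_order (left_defect eta beta u) 0) as [Hneg|[H0|Hpos]].
      * right; left. split; [lra|].
        (* If x is not 0, take an approximation with [xs] closer to x than 0 is, and with defect
           error and tolerance at most a third of the limit defect: none of its three alternatives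
           is then possible. *)
        destruct (Req_dec x 0) as [E|Hn]; [unfold m; rewrite E; ring|exfalso].
        set (d := left_defect eta beta u) in *.
        apply Rabs_pos_lt in Hn.
        destruct (Hdef (Rmin (Rabs x) (- d / 3)) ltac:(apply Rmin_glb_lt; lra))
          as (n & He & Hxn & H2 & _).
        assert (M1 := Rmin_l (Rabs x) (- d / 3)). assert (M2 := Rmin_r (Rabs x) (- d / 3)).
        destruct (Hxy (f (phi n))) as (_ & _ & _ & [H3|[[H3 _]|[_ H3]]]).
        -- apply Rabs_le_between in H2. apply Rabs_le_between in H3. lra.
        -- rewrite H3, Rminus_0_l, Rabs_Ropp in Hxn. lra.
        -- apply Rabs_le_between in H2. lra.
      * left. split; [assumption|]. destruct Hx01. unfold m, Rmin, Rmax.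
        destruct Rle_dec; split; nra.
      * right; right. split; [lra|].
        destruct (Req_dec x 1) as [E|Hn]; [unfold m; rewrite E; ring|exfalso].
        set (d := left_defect eta beta u) in *.
        assert (Hn' : 1 - x <> 0) by lra. apply Rabs_pos_lt in Hn'.
        destruct (Hdef (Rmin (Rabs (1 - x)) (d / 3)) ltac:(apply Rmin_glb_lt; lra))
          as (n & He & Hxn & H2 & _).
        assert (M1 := Rmin_l (Rabs (1 - x)) (d / 3)). assert (M2 := Rmin_r (Rabs (1 - x)) (d / 3)).
        destruct (Hxy (f (phi n))) as (_ & _ & _ & [H3|[[_ H3]|[H3 _]]]).
        -- apply Rabs_le_between in H2. apply Rabs_le_between in H3. lra.
        -- apply Rabs_le_between in H2. lra.
        -- rewrite H3 in Hxn. lra.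
Qed.

(** * Comparison with the linear problem *)

Lemma RInt_weighted_pos (eta T t0 : R) (a : R -> R) :
  eta < T -> continuous_R a -> (forall r, 0 <= a r) -> cc eta T t0 -> 0 < a t0 ->
  0 < RInt (fun s => (T - s) * a s) eta T.
Proof.
  intros HeT Ha H0 Ht0 Hpos. unfold cc in Ht0.
  assert (Hk := continuous_R_kernel a T Ha).
  destruct (proj1 (filterlim_locally _ _) (Ha t0) (mkposreal _ Hpos)) as (d & Hd).
  assert (Hloc : forall x, Rabs (x - t0) < d -> 0 < a x).
  { intros x Hx. specialize (Hd x Hx). simpl in Hd.
    change (Rabs (a x - a t0) < a t0) in Hd. apply Rabs_lt_between in Hd. lra. }
  (* t0 may be an end point, so the interval is taken on its side facing the midpoint of [eta,T].
     Being open, it also avoids the zero of the weight at T. *)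
  assert (Hsub : exists l r, eta <= l < r /\ r <= T /\ forall x, l < x < r -> Rabs (x - t0) < d).
  { assert (Hdp := cond_pos d).
    set (e := Rmin d (T - eta) / 2).
    assert (0 < e /\ e < d /\ e <= (T - eta) / 2).
    { unfold e, Rmin. destruct Rle_dec; lra. }
    destruct (Rle_dec t0 ((eta + T) / 2)).
    - exists t0, (t0 + e). repeat split; try lra. intros x Hx. rewrite Rabs_pos_eq; lra.
    - exists (t0 - e), t0. repeat split; try lra. intros x Hx.
      rewrite Rabs_left; lra. }
  destruct Hsub as (l & r & Hl & Hr & Hlr).
  rewrite <- (RInt_chasles_R _ eta l T), <- (RInt_chasles_R _ l r T) by assumption.
  assert (Hge : forall b c, eta <= b -> b <= c <= T -> 0 <= RInt (fun s => (T - s) * a s) b c).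
  { intros b c Hb Hbc. apply RInt_ge_0; [lra|now apply ex_RInt_continuous_R|].
    intros x Hx. apply Rmult_le_pos; [lra|apply H0]. }
  assert (H1 := Hge eta l ltac:(lra) ltac:(lra)).
  assert (H2 := Hge r T ltac:(lra) ltac:(lra)).
  assert (H3 : 0 < RInt (fun s => (T - s) * a s) l r).
  { apply RInt_gt_0; [lra| |intros; apply Hk].
    intros x Hx. apply Rmult_lt_0_compat; [lra|]. apply Hloc, Hlr, Hx. }
  lra.
Qed.

(** The source bound gives B <= M rho A, and Lambda_1 is the threshold at which [cap_upper] yields
    at most rho. Strictness comes from terms that this estimate does not use up. *)
Lemma cap_below_of_small_source (T eta alpha beta rho M A p q delta tau : R) (y a : R -> R) :
  continuous_R y -> (forall r, 0 <= y r) -> continuous_R a ->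
  0 < eta < T -> 0 < alpha -> 0 < 2 * T - alpha * eta ^ 2 -> 0 <= beta ->
  0 < bvp_det T eta alpha beta -> 0 < rho -> 0 < M ->
  A = RInt (fun s => (T - s) * a s) 0 T -> 0 < A ->
  M <= bvp_det T eta alpha beta
       / ((2 * (beta + 1) + / T * beta * eta * (alpha * eta + 2) + alpha * beta * T) * (T * A)) ->
  (forall t, cc 0 T t -> y t <= M * rho * a t) ->
  delta <= 0 ->
  cap p q y 0 = beta * cap p q y eta + delta ->
  cap p q y T = alpha * RInt (cap p q y) 0 eta ->
  cc 0 T tau -> cap p q y tau < rho.
Proof.
  intros Hy H0 Hac Heta Hal Ha2 Hb HD Hrho HM EA HA HML Hya Hd E1 E2 Htau.
  assert (Hup := cap_upper T eta alpha beta p q delta y Hy H0 Heta Hal Ha2 Hb Hd E1 E2 tau Htau).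
  unfold cc in Htau.
  assert (HI := iint_nonneg y tau Hy H0). assert (HB := iint_nonneg y T Hy H0).
  assert (HBA : iint y T <= M * rho * A).
  { rewrite EA. unfold iint. rewrite <- RInt_scal_R by now apply continuous_R_kernel.
    apply RInt_le_R; [lra|now apply continuous_R_kernel| |].
    - apply continuous_R_mult; [apply continuous_R_const|now apply continuous_R_kernel].
    - intros s Hs. assert (H := Hya s Hs).
      apply Rle_trans with ((T - s) * (M * rho * a s)); [apply Rmult_le_compat_l; lra|].
      right; ring. }
  set (D := bvp_det T eta alpha beta) in *.
  set (K1 := 2 * (beta + 1) + / T * beta * eta * (alpha * eta + 2) + alpha * beta * T) in *.
  set (K2 := 2 * T + 4 * beta * eta + alpha * beta * eta ^ 2).
  assert (Hab : 0 <= alpha * beta) by (apply Rmult_le_pos; lra).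
  assert (Hbe : 0 <= beta * eta) by (apply Rmult_le_pos; lra).
  assert (HKT : K1 * T = 2 * T * (beta + 1) + beta * eta * (alpha * eta + 2) + alpha * beta * T ^ 2).
  { unfold K1. field. lra. }
  assert (HK2 : 0 < K2).
  { unfold K2. assert (0 <= alpha * beta * eta ^ 2) by (apply Rmult_le_pos; nra). lra. }
  (* The difference is 2 beta (T - eta) + alpha beta T^2. *)
  assert (HK12 : K2 <= K1 * T).
  { rewrite HKT. unfold K2.
    assert (0 <= beta * (T - eta)) by (apply Rmult_le_pos; lra).
    assert (0 <= alpha * beta * T ^ 2) by (apply Rmult_le_pos; nra). nra. }
  assert (HK1A : 0 < K1 * (T * A)).
  { rewrite <- Rmult_assoc. apply Rmult_lt_0_compat; lra. }
  assert (HMD : M * (K1 * (T * A)) <= D) by (apply Rle_div_r; assumption).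
  assert (HBK : iint y T * K2 <= D * rho).
  { apply Rle_trans with (M * rho * A * (K1 * T)).
    - apply Rmult_le_compat; lra.
    - replace (M * rho * A * (K1 * T)) with (M * (K1 * (T * A)) * rho) by ring.
      apply Rmult_le_compat_r; lra. }
  apply Rmult_lt_reg_l with D; [assumption|].
  apply Rle_lt_trans with (1 := Hup).
  assert (HDI : 0 <= D * iint y tau) by (apply Rmult_le_pos; lra).
  assert (HDrho : 0 < D * rho) by now apply Rmult_lt_0_compat.
  (* Strictness: if B = 0 the bound is 0 < D rho; if tau < T the term 2 (T - tau) B is gained; if
     tau = T the subtracted D B is positive. *)
  replace (2 * tau + 4 * beta * eta + alpha * beta * eta ^ 2)
    with (K2 - 2 * (T - tau)) by (unfold K2; ring).
  destruct (Req_dec (iint y T) 0) as [E|Hn]; [rewrite E; lra|].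
  destruct (Req_dec tau T) as [->|Hn'].
  - assert (0 < D * iint y T) by (apply Rmult_lt_0_compat; lra). lra.
  - assert (0 < iint y T * (T - tau)) by (apply Rmult_lt_0_compat; lra). lra.
Qed.

(** By [cap_eta_lower], D u(eta) >= 2 eta M rho Q, which is at least D rho / gamma; gamma < 1 makes
    the conclusion strict. *)
Lemma cap_above_of_large_source (T eta alpha beta rho M Q p q delta : R) (y a : R -> R) :
  continuous_R y -> (forall r, 0 <= y r) -> continuous_R a ->
  0 < eta < T -> 0 < alpha -> 0 <= beta ->
  0 < bvp_det T eta alpha beta -> 0 < rho ->
  Q = RInt (fun s => (T - s) * a s) eta T -> 0 < Q ->
  bvp_det T eta alpha beta / (2 * gamma_const T eta alpha beta * eta * Q) <= M ->
  (forall t, cc eta T t -> M * rho * a t <= y t) ->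
  0 <= delta ->
  cap p q y 0 = beta * cap p q y eta + delta ->
  cap p q y T = alpha * RInt (cap p q y) 0 eta ->
  rho < cap p q y eta.
Proof.
  intros Hy H0 Hac Heta Hal Hb HD Hrho EQ HQ HML Hya Hd E1 E2.
  assert (Hlo := cap_eta_lower T eta alpha beta p q delta y Hy H0 Heta Hal Hd E1 E2).
  destruct (gamma_const_pos T eta alpha beta Heta Hal Hb HD) as (_ & [Hg0 Hg1] & _).
  assert (Hg : gamma_const T eta alpha beta < 1).
  { apply Rle_lt_trans with (1 := Hg1). apply Rlt_div_l; lra. }
  set (D := bvp_det T eta alpha beta) in *. set (g := gamma_const T eta alpha beta) in *.
  assert (HQy : M * rho * Q <= RInt (fun s => (T - s) * y s) eta T).
  { rewrite EQ. rewrite <- RInt_scal_R by now apply continuous_R_kernel.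
    apply RInt_le_R; [lra| |now apply continuous_R_kernel|].
    - apply continuous_R_mult; [apply continuous_R_const|now apply continuous_R_kernel].
    - intros s Hs. assert (H := Hya s Hs).
      apply Rle_trans with ((T - s) * (M * rho * a s)); [right; ring|].
      apply Rmult_le_compat_l; lra. }
  assert (HgQ : 0 < 2 * g * eta * Q) by (repeat apply Rmult_lt_0_compat; lra).
  assert (HMD : D <= M * (2 * g * eta * Q)) by (apply Rle_div_l; assumption).
  set (X := 2 * eta * M * Q).
  assert (HgX : D <= g * X).
  { apply Rle_trans with (1 := HMD). right. unfold X. ring. }
  assert (HX : 0 < X) by (apply Rmult_lt_reg_l with g; lra).
  assert (HDX : D < X) by nra.
  assert (H1 : 2 * eta * (M * rho * Q) <= 2 * eta * RInt (fun s => (T - s) * y s) eta T)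
    by (apply Rmult_le_compat_l; lra).
  replace (2 * eta * (M * rho * Q)) with (X * rho) in H1 by (unfold X; ring).
  apply Rmult_lt_reg_l with D; [assumption|].
  assert (D * rho < X * rho) by now apply Rmult_lt_compat_r.
  lra.
Qed.

(** * Regularity and norm of the solution, and the existence theorem *)

Lemma Derive_cap (p q : R) (y : R -> R) (t : R) : continuous_R y ->
  Derive (cap p q y) t = q - RInt y 0 t.
Proof. intros Hy. apply is_derive_unique. now apply is_derive_cap. Qed.

Lemma is_derive_Derive_cap (p q : R) (y : R -> R) (t : R) : continuous_R y ->
  is_derive (Derive (cap p q y)) t (- y t).
Proof.
  intros Hy. apply is_derive_ext with (fun t => q - RInt y 0 t).
  { intros s. symmetry. now apply Derive_cap. }
  replace (- y t) with (minus 0 (y t)) by (unfold minus, plus, opp; simpl; ring).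
  apply (is_derive_minus (fun _ => q) (fun t => RInt y 0 t)).
  - apply (is_derive_const (K := R_AbsRing) (V := R_NormedModule)).
  - now apply is_derive_RInt_R.
Qed.

Lemma Derive_n_2_cap (p q : R) (y : R -> R) (t : R) : continuous_R y ->
  Derive_n (cap p q y) 2 t = - y t.
Proof.
  intros Hy. simpl.
  rewrite (Derive_ext _ (Derive (cap p q y))) by reflexivity.
  apply is_derive_unique. now apply is_derive_Derive_cap.
Qed.

Lemma continuous_on_continuous_R (D : R -> Prop) (u : R -> R) :
  continuous_R u -> continuous_on D u.
Proof.
  intros Hu x _. apply filterlim_filter_le_1 with (2 := Hu x). apply filter_le_within.
Qed.

Lemma cap_C2 (a b p q : R) (y : R -> R) : continuous_R y -> C2_open a b (cap p q y).
Proof.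
  intros Hy t _. split; [|split].
  - eexists. now apply is_derive_cap.
  - eexists. now apply is_derive_Derive_cap.
  - apply continuous_ext with (fun t => - y t).
    + intros s. symmetry. now apply Derive_n_2_cap.
    + apply (continuous_opp y). apply Hy.
Qed.

Lemma sup_norm_eq (T tau : R) (u : R -> R) : cc 0 T tau ->
  (forall t, cc 0 T t -> 0 <= u t <= u tau) -> sup_norm T u = u tau.
Proof.
  intros Htau Hu. unfold sup_norm.
  rewrite (is_lub_Rbar_unique _ (Finite (u tau))); [reflexivity|]. split.
  - intros x (t & Ht & ->). simpl. rewrite Rabs_pos_eq; now apply Hu.
  - intros b Hb. apply Hb. exists tau. split; [assumption|].
    rewrite Rabs_pos_eq; [reflexivity|]. now apply Hu.
Qed.

Theorem theorem4p1
  (T eta alpha beta : R) (f a : R -> R) (rho1 M1 rho2 M2 : R)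
  (Heta : 0 < eta < T)
  (Halpha : 0 < alpha < 2 * T / eta ^ 2)
  (Hbeta : 0 <= beta
           < (2 * T - alpha * eta ^ 2) / (alpha * eta ^ 2 - 2 * eta + 2 * T))
  (Hf_cont : continuous_on (fun x => 0 <= x) f)
  (Hf_nonneg : forall x, 0 <= x -> 0 <= f x)
  (Ha_cont : continuous_on (cc 0 T) a)
  (Ha_nonneg : forall t, cc 0 T t -> 0 <= a t)
  (Ha_pos : exists t0, cc eta T t0 /\ 0 < a t0)
  (Hrho1 : 0 < rho1)
  (HM1 : 0 < M1 <= Lambda1 T eta alpha beta a)
  (Hf1 : forall x, cc 0 rho1 x -> f x <= M1 * rho1)
  (Hrho2 : 0 < rho2)
  (HM2 : Lambda2 T eta alpha beta a <= M2)
  (Hf2 : forall x, cc (gamma_const T eta alpha beta * rho2) rho2 x ->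
         M2 * rho2 <= f x)
  (Hrho : rho1 <> rho2) :
  exists u : R -> R,
    bvp_positive_solution T eta alpha beta a f u /\
    (rho1 < sup_norm T u < rho2 \/ rho2 < sup_norm T u < rho1).
Proof.
  assert (Ha2 : 0 < 2 * T - alpha * eta ^ 2).
  { destruct Halpha as [_ H]. apply Rlt_div_r in H; [lra|nra]. }
  assert (Hal : 0 < alpha) by lra. assert (Hb : 0 <= beta) by lra.
  assert (HD : 0 < bvp_det T eta alpha beta).
  { assert (0 < alpha * eta ^ 2) by (apply Rmult_lt_0_compat; nra).
    destruct Hbeta as [_ H1]. apply Rlt_div_r in H1; [|lra]. unfold bvp_det. lra. }
  destruct (gamma_const_pos T eta alpha beta Heta Hal Hb HD) as (_ & [Hg0 Hg1] & _).
  set (hi := Rmax rho1 rho2).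
  assert (Hhi1 : rho1 <= hi) by apply Rmax_l. assert (Hhi2 : rho2 <= hi) by apply Rmax_r.
  (* The truncation makes F bounded and uniformly continuous. It is invisible in the end, as the
     solution takes its values in [0,hi]. *)
  set (a1 := fun t => a (clip 0 T t)). set (F := fun x => f (clip 0 hi x)).
  assert (Ha1 : forall t, cc 0 T t -> a1 t = a t).
  { intros t Ht. unfold a1. now rewrite clip_id. }
  assert (HaC : continuous_R a1) by (apply continuous_on_comp_clip with (cc 0 T); auto; lra).
  assert (HFC : continuous_R F).
  { apply continuous_on_comp_clip with (fun x => 0 <= x); auto; [lra|]. unfold cc. intros; lra. }
  destruct (comp_clip_bounded a 0 T ltac:(lra) Ha_nonneg HaC) as (aM & HaM & HaB).
  destruct (comp_clip_bounded f 0 hi ltac:(lra) (fun x Hx => Hf_nonneg x (proj1 Hx)) HFC)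
    as (FM & HFM & HFB).
  destruct (exact_shot T eta alpha beta rho1 rho2 aM FM a1 F)
    as (p & q & y & tau & Hy & Hy0 & Hyeq & Htau & Hmax & Hright & Hcases);
    try assumption.
  { exact (comp_clip_uniformly_continuous a 0 T ltac:(lra) HaC). }
  { exact (comp_clip_uniformly_continuous f 0 hi ltac:(lra) HFC). }
  unfold right_defect, left_defect in *.
  set (u := cap p q y) in *.
  assert (HT : u T = alpha * RInt u 0 eta) by lra.
  assert (Ha10 : forall t, 0 <= a1 t) by (intros; apply HaB).
  destruct Ha_pos as (t0 & Ht0 & Hat0).
  assert (Hat0' : 0 < a1 t0) by (rewrite Ha1; [assumption|unfold cc in *; lra]).
  assert (HQ : 0 < RInt (fun s => (T - s) * a1 s) eta T)
    by (apply RInt_weighted_pos with t0; auto; lra).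
  assert (HA : 0 < RInt (fun s => (T - s) * a1 s) 0 T)
    by (apply RInt_weighted_pos with t0; auto; [lra|unfold cc in *; lra]).
  assert (HnotR1 : u 0 - beta * u eta <= 0 -> u tau <> rho1).
  { intros Hd Em. apply (Rlt_irrefl rho1). rewrite <- Em at 1.
    apply (cap_below_of_small_source T eta alpha beta rho1 M1
      (RInt (fun s => (T - s) * a1 s) 0 T) p q (u 0 - beta * u eta) tau y a1);
      auto; try lra.
    - destruct HM1 as [_ HM1].
      replace (T * RInt (fun s => (T - s) * a1 s) 0 T) with (RInt (fun s => T * (T - s) * a s) 0 T).
      + exact HM1.
      + rewrite <- RInt_scal_R by now apply continuous_R_kernel.
        apply (RInt_ext (V := R_CompleteNormedModule)).
        rewrite (Rmin_left 0 T), (Rmax_right 0 T) by lra. intros s Hs.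
        rewrite Ha1 by (unfold cc; lra). simpl. ring.
    (* With a nonpositive left defect u may be negative, but [clip] sends negative values to 0,
       where the bound on f still applies. *)
    - intros t Ht. rewrite Hyeq, Rmult_comm by assumption. apply Rmult_le_compat_r; [auto|].
      apply Hf1. assert (H1 := Hmax t Ht). fold u in H1. rewrite Em in H1.
      unfold cc, clip, Rmax, Rmin. repeat destruct Rle_dec; lra.
    - fold u. lra. }
  assert (HnotR2 : 0 <= u 0 - beta * u eta -> u tau <> rho2).
  { intros Hd Em. apply (Rlt_irrefl rho2).
    apply Rlt_le_trans with (u eta); [|rewrite <- Em; apply Hmax; unfold cc; lra].
    apply (cap_above_of_large_source T eta alpha beta rho2 M2 _ p q (u 0 - beta * u eta) y a1
      Hy Hy0 HaC Heta Hal Hb HD Hrho2 eq_refl); auto; try lra.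
    - replace (RInt (fun s => (T - s) * a1 s) eta T) with (RInt (fun s => (T - s) * a s) eta T).
      + exact HM2.
      + apply (RInt_ext (V := R_CompleteNormedModule)).
        rewrite (Rmin_left eta T), (Rmax_right eta T) by lra. intros s Hs.
        rewrite Ha1 by (unfold cc; lra). reflexivity.
    - intros t Ht.
      (* The nonnegative left defect makes this applicable: on [eta,T] the values of u lie between
         gamma rho_2 and rho_2, where f is bounded below. *)
      assert (Hgt := cap_gamma T eta alpha beta p q tau y Hy Hy0 Heta Hal Hb HD
                       ltac:(fold u; lra) HT Htau Hmax t Ht).
      fold u in Hgt. rewrite Em in Hgt. unfold cc in Ht.
      assert (Ht' : cc 0 T t) by (unfold cc; lra).
      assert (H1 := Hmax t Ht'). fold u in H1. rewrite Em in H1.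
      assert (0 < gamma_const T eta alpha beta * rho2) by now apply Rmult_lt_0_compat.
      rewrite Hyeq by assumption. rewrite (Rmult_comm (a1 t)).
      apply Rmult_le_compat_r; [auto|]. fold u.
      unfold F. rewrite clip_id by (unfold cc; lra). apply Hf2. unfold cc; lra.
    - fold u. lra. }
  destruct Hcases as [[H0 Hm]|[[H0 Hm]|[H0 Hm]]];
    [|exfalso; now apply HnotR1|exfalso; now apply HnotR2].
  (* A zero defect meets the sign conditions of both exclusions, so the maximum differs from rho_1
     and from rho_2. *)
  assert (Hn1 := HnotR1 ltac:(lra)). assert (Hn2 := HnotR2 ltac:(lra)).
  destruct (cap_nonneg T eta alpha beta p q y Hy Hy0 Heta Hal Hb HD ltac:(fold u; lra) HT)
    as (P0 & Pe & PT).
  assert (Hmpos : 0 < u tau).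
  { apply Rlt_le_trans with (2 := proj1 Hm). now apply Rmin_glb_lt. }
  destruct (cap_pos T p q tau y Hy Hy0 P0 PT Htau Hmpos) as [Hnn Hpp].
  fold u in Hnn, Hpp.
  exists u. split.
  - constructor; auto; try lra.
    + now apply continuous_on_continuous_R, continuous_R_cap.
    + now apply cap_C2.
    + intros t Ht. unfold u. rewrite Derive_n_2_cap by assumption. fold u.
      assert (Ht' : cc 0 T t) by (unfold cc; lra).
      rewrite Hyeq by assumption. rewrite Ha1 by assumption. fold u. unfold F.
      rewrite clip_id; [ring|].
      split; [now apply Hnn|]. apply Rle_trans with (1 := Hmax t Ht'). apply Hm.
  - rewrite (sup_norm_eq T tau u Htau (fun t Ht => conj (Hnn t Ht) (Hmax t Ht))).
    revert Hm. unfold Rmin, Rmax. destruct Rle_dec; lra.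
Qed.
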